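(* For an integer $p\ge 1$ let $\mathrm{TW}(p)$ be the family of all graphs of treewidth at most $p$. There exist absolute constants $c,C>0$ such that for all integers $p\ge 1$ and $k\ge p$, $$c\,pk\;\le\; f^*(k,\mathrm{TW}(p))\;\le\; C\,p^3k .$$
   Context: All graphs are finite and undirected, with nonnegative edge lengths $\ell:E(G)\to\mathbb{R}_{\ge 0}$; $d_H$ denotes shortest-path distance in a graph $H$ with respect to its edge lengths. Given a graph $G=(V,E,\ell)$ and a set of terminals $R\subseteq V$, a distance-preserving minor of $G$ with respect to $R$ is a graph $G'$ with edge lengths $\ell'$ (which may differ from $\ell$) such that $G'$ is a minor of $G$ in which the terminals survive (terminals are never deleted and no two terminals are merged; a terminal may be merged with non-terminals by edge contraction, and the resulting vertex is identified with that terminal), so $R\subseteq V(G')$, and $d_{G'}(u,v)=d_G(u,v)$ for all $u,v\in R$. For a family $\mathcal{F}$ of graphs (defined irrespective of edge lengths), $f^*(k,\mathcal{F})$ is the minimum number such that every graph in $\mathcal{F}$, with any nonnegative edge lengths and any set of $k$ terminals, admits a distance-preserving minor with at most $f^*(k,\mathcal{F})$ vertices. *)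

(* Defs.v *)
From HB Require Import structures.
From mathcomp Require Import all_boot all_order all_algebra.
From mathcomp Require Import boolp classical_sets reals ereal.

Set Implicit Arguments.
Unset Strict Implicit.
Unset Printing Implicit Defensive.

Import Order.TTheory GRing.Theory Num.Theory.

(* A simple graph whose vertices are drawn from an ambient finite type V.  The
   vertex set is explicit so that a minor of G lives in the same type as G and
   keeps the names of the surviving vertices.  The well-formedness condition
   is boolean, so two graphs are equal iff their vertex and edge sets are. *)
Record graph (V : finType) := Graph {
  verts : {set V};
  edges : {set {set V}};
  edges_wf : [forall e in edges, (e \subset verts) && (#|e| == 2)]
}.

Definition adj (V : finType) (G : graph V) : rel V :=
  fun x y => [set x; y]%SET \in edges G.

Definition connected_in (V : finType) (G : graph V) (A : {set V}) : Prop :=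
  {in A &, forall x y, connect [rel a b in A | adj G a b] x y}.

(* A duplicate-free closed walk of size 2 just traverses an edge back and
   forth; those of size at least 3 are the cycles. *)
Definition is_tree (V : finType) (T : graph V) : Prop :=
  [/\ verts T != finset.set0,
      connected_in T (verts T) &
      forall c : seq V, ucycle (adj T) c -> size c <= 2].

Definition tree_decomposition (V I : finType) (G : graph V) (T : graph I)
    (B : I -> {set V}) : Prop :=
  [/\ is_tree T,
      (\bigcup_(i in verts T) B i)%SET = verts G,
      forall e, e \in edges G -> exists2 i, i \in verts T & e \subset B i &
      forall v, v \in verts G ->
        connected_in T [set i in verts T | v \in B i]%SET].

(* The truncated predecessor gives width 0, not -1, to the empty graph. *)
Definition width (V I : finType) (T : graph I) (B : I -> {set V}) : nat :=
  (\max_(i in verts T) #|B i|).-1.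

Definition is_min (P : nat -> Prop) (m : nat) : Prop :=
  P m /\ forall n, P n -> m <= n.

Definition is_treewidth (V : finType) (G : graph V) (w : nat) : Prop :=
  is_min (fun n => exists (I : finType) (T : graph I) (B : I -> {set V}),
            tree_decomposition G T B /\ width T B = n) w.

Definition graph_family := forall V : finType, graph V -> Prop.

Definition TW (p : nat) : graph_family :=
  fun V G => exists2 w, is_treewidth G w & w <= p.

Section MinorOperations.
Variables (V : finType) (G : graph V).

Lemma del_edge_wf (e : {set V}) :
  [forall f in edges G :\ e, (f \subset verts G) && (#|f| == 2)].
Proof.
apply/forall_inP => f /setD1P[_ fG].
exact: (forall_inP (edges_wf G)).
Qed.

Definition del_edge (e : {set V}) : graph V := Graph (del_edge_wf e).

Lemma del_vertex_wf (v : V) :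
  [forall f in [set e in edges G | v \notin e]%SET,
     (f \subset verts G :\ v) && (#|f| == 2)].
Proof.
apply/forall_inP => f; rewrite inE => /andP[fG vf].
by have /andP[fV ->] := forall_inP (edges_wf G) _ fG; rewrite subsetD1 fV vf.
Qed.

Definition del_vertex (v : V) : graph V := Graph (del_vertex_wf v).

Definition merge (u v x : V) : V := if x == v then u else x.

Lemma contract_wf (u v : V) :
  [forall f in [set merge u v @: (e : {set V}) | e in edges G :\ [set u; v]]%SET,
     (f \subset merge u v @: verts G) && (#|f| == 2)].
Proof.
apply/forall_inP => f /imsetP[e /setD1P[euv eG] ->].
have /andP[eV /eqP e2] := forall_inP (edges_wf G) _ eG.
rewrite imsetS //= card_in_imset ?e2 //.
have key x y : x \in e -> y \in e -> x = v -> y != v -> u = y -> False.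
  move=> xe ye xv yv uy; case/negP: euv; rewrite eq_sym eqEcard e2 cards2.
  rewrite uy yv andbT; apply/fintype.subsetP => z; rewrite !inE.
  by case/orP => /eqP ->; rewrite -?xv.
move=> x y xe ye; rewrite /merge.
have [xv|xv] := eqVneq x v; have [yv|yv] := eqVneq y v => //.
- by move=> _; rewrite xv yv.
- by move=> /(key _ _ xe ye xv yv).
- by move=> /esym /(key _ _ ye xe yv xv).
Qed.

(* Contraction of the edge uv; the resulting vertex is named u.  The loop and
   the parallel edges that it creates disappear. *)
Definition contract (u v : V) : graph V := Graph (contract_wf u v).

End MinorOperations.

(* terminal_minor S G H: H arises from G by edge deletions, vertex deletions
   and edge contractions in which the terminals S survive.  A contraction
   keeps the name of its first endpoint, hence only the second one has to be a
   non-terminal: this covers all contractions except those merging two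
   terminals. *)
Inductive terminal_minor (V : finType) (S : {set V}) (G : graph V) :
    graph V -> Prop :=
| TMinorRefl : terminal_minor S G G
| TMinorDelEdge (H : graph V) (e : {set V}) of
    terminal_minor S G H & e \in edges H :
    terminal_minor S G (del_edge H e)
| TMinorDelVertex (H : graph V) (v : V) of
    terminal_minor S G H & v \in verts H :\: S :
    terminal_minor S G (del_vertex H v)
| TMinorContract (H : graph V) (u v : V) of
    terminal_minor S G H & adj H u v & v \notin S :
    terminal_minor S G (contract H u v).

(* Edge lengths are functions on sets of vertices of which only the values on
   the edges of the graph matter. *)
Definition nonneg_lengths (R : realType) (V : finType) (G : graph V)
    (l : {set V} -> R) : Prop :=
  forall e, e \in edges G -> (0 <= l e)%R.

Definition path_length (R : realType) (V : finType) (l : {set V} -> R)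
    (x : V) (p : seq V) : R :=
  (\sum_(e <- pairmap (fun a b => [set a; b]%SET) x p) l e)%R.

(* The infimum ranges over finitely many paths, so it is a minimum whenever
   there is a path at all; it is +oo otherwise. *)
Definition dist (R : realType) (V : finType) (G : graph V) (l : {set V} -> R)
    (x y : V) : \bar R :=
  ereal_inf [set (path_length l x p)%:E |
    p in [set p : seq V | [/\ path (adj G) x p, uniq (x :: p) & last x p = y]]
  ]%classic.

Definition distance_preserving_minor (R : realType) (V : finType)
    (G : graph V) (l : {set V} -> R) (S : {set V})
    (G' : graph V) (l' : {set V} -> R) : Prop :=
  [/\ terminal_minor S G G', nonneg_lengths G' l' &
      {in S &, forall u v, dist G' l' u v = dist G l u v}].

Definition admits_dp_minors (R : realType) (k : nat) (F : graph_family)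
    (m : nat) : Prop :=
  forall (V : finType) (G : graph V) (l : {set V} -> R) (S : {set V}),
    F V G -> nonneg_lengths G l -> S \subset verts G -> #|S| = k ->
    exists (G' : graph V) (l' : {set V} -> R),
      distance_preserving_minor G l S G' l' /\ #|verts G'| <= m.

(* is_fstar R k F m: the number f^*(k, F), for edge lengths in R, is m. *)
Definition is_fstar (R : realType) (k : nat) (F : graph_family) (m : nat) :
    Prop :=
  is_min (admits_dp_minors R k F) m.

(* Main.v *)
(* Upper bound.  A tree decomposition of width < q cuts G into O(k/q) regions,
   each with O(q) terminals of its own, any two of which meet only in vertices
   that are terminals of both.  In a region, perturb the lengths so that
   shortest paths are unique: two of them then meet in a common subpath, so the
   union of those joining the terminals has O(q^4) vertices of degree at least
   3.  Keep these paths only and suppress the other nonterminals of degree at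
   most 2.

   Lower bound.  In the r x N grid with unit lengths and a terminal set
   containing the boundary, d(L_i,R_i) + d(L_j,R_j) < d(L_i,R_j) + d(L_j,R_i) for
   the ends of two rows i and j, so shortest paths of a distance-preserving minor
   joining the ends of different rows are disjoint.  They lift to r disjoint
   connected sets that cross the grid, which must be the rows themselves.  Hence
   vertices in different rows, and likewise in different columns, are never
   merged or deleted: the minor has rN vertices. *)
From HB Require Import structures.
From mathcomp Require Import boolp classical_sets reals ereal.
From mathcomp Require Import all_boot all_order all_algebra.
From mathcomp Require Import zify ring lra.
Require Import Defs.

Set Implicit Arguments.
Unset Strict Implicit.
Unset Printing Implicit Defensive.

Import Order.TTheory GRing.Theory Num.Theory.
Local Open Scope ring_scope.

(** * Walks and distances *)

(** The exponents come from q = p + 1: there are O(k/q) regions at O(q^4) vertices each, hence O(p^3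
    k). The factor q^4 counts pairs of shortest paths, that is, quadruples of terminals of one
    region. Separators do not make the terminals proliferate: a cut removes at least 2q terminals
    from the remaining part and adds at most q. Cutting loses no distances, because a walk passes
    from one region to another only at a common terminal; it is enough to preserve distances inside
    each region.

    For the lower bound r is about p/4 and N about k/4. The boundary then has at most k vertices,
    the treewidth is at most r, and the area rN is of order pk.

    A distance is an infimum of extended reals, so the arguments use the relation [walk], whose last
    argument is only an upper bound for the length. Two vertices have equal distances in two graphs
    as soon as the same bounds hold in both, connected or not. *)

Section Walks.
Variables (R : realType) (V : finType).
Implicit Types (F A B : {set {set V}}) (l : {set V} -> R) (x y z : V) (r : R).

Definition within F : rel V := fun x y => [set x; y] \in F.

Lemma within_sym F : symmetric (within F).
Proof. by move=> x y; rewrite /within setUC. Qed.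

Lemma conn_sym F x y : connect (within F) x y = connect (within F) y x.
Proof. exact: (sym_connect_sym (@within_sym F)). Qed.

Lemma sub_conn F F' x y : F \subset F' ->
  connect (within F) x y -> connect (within F') x y.
Proof.
by move=> /subsetP s; apply: connect_sub => a b ab; apply/connect1/s.
Qed.

Lemma path_avoid F x y z p : path (within F) z p -> x \notin z :: p ->
  path (within (F :\ [set x; y])) z p.
Proof.
move=> pP xp; apply: (sub_in_path (P := mem (z :: p))) pP; last exact/allP.
move=> a b ap bp; rewrite /within !inE => ->; rewrite andbT.
apply: contra xp => /eqP E; have : x \in [set a; b] by rewrite E set21.
by rewrite !inE => /orP[] /eqP ->.
Qed.

(* [walk F l y x r]: some walk from x to y along F has length at most r. *)
Inductive walk F l y : V -> R -> Prop :=
| walk_nil r : 0 <= r -> walk F l y y r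
| walk_cons x x' r r' : [set x; x'] \in F -> walk F l y x' r' ->
    l [set x; x'] + r' <= r -> walk F l y x r.

Lemma walk_le F l y x r r' : r <= r' -> walk F l y x r -> walk F l y x r'.
Proof.
move=> rr' w; case: w rr' => [s s0|u u' s s' e w le] sr'.
  by apply: walk_nil; apply: le_trans sr'.
by apply: walk_cons e w _; apply: le_trans sr'.
Qed.

Lemma walk_sub F F' l y x r : F \subset F' -> walk F l y x r -> walk F' l y x r.
Proof.
move=> /subsetP FF'; elim=> [s s0|u u' s s' /FF' e _ w le].
  exact: walk_nil.
exact: walk_cons e w le.
Qed.

Lemma walk_cat F l y x z r r' :
  walk F l y x r -> walk F l z y r' -> walk F l z x (r + r').
Proof.
move=> w w'; elim: w => [s s0|u u' s s' e _ IH le].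
  by apply: walk_le w'; rewrite lerDr.
by apply: walk_cons e IH _; lra.
Qed.

Lemma walk1 F l x y : [set x; y] \in F -> walk F l y x (l [set x; y]).
Proof. by move=> e; apply: (walk_cons e (walk_nil _ _ _ (lexx 0))); rewrite addr0. Qed.

Lemma walk_sym F l y x r : walk F l y x r -> walk F l x y r.
Proof.
elim=> [s s0|u u' s s' e _ IH le]; first exact: walk_nil.
have w : walk F l u u' (l [set u; u']).
  by rewrite setUC; apply: walk1; rewrite setUC.
by apply: walk_le (walk_cat IH w); rewrite addrC.
Qed.

Lemma walk_conn F l y x r : walk F l y x r -> connect (within F) x y.
Proof.
elim=> [s _|u u' s s' e _ IH _] //.
exact: connect_trans (connect1 _) IH.
Qed.

(** A simple path uses every edge at most once, so the total length of [A] bounds it. Together with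
    [conn_of_walk] this trades walks for edge sets, and it is sums over edge sets that generic
    weights tell apart. *)
Lemma walk_of_conn A l x y : (forall e, e \in A -> 0 <= l e) ->
  connect (within A) x y -> walk A l y x (\sum_(e in A) l e).
Proof.
move=> l0 /connectP[p0 p0P ->]; case/shortenP: p0P => p pP up _ {p0 y}.
elim: p x A l0 pP up => [|y p IH] x A l0 /=.
  by move=> _ _; apply: walk_nil; apply: sumr_ge0.
case/andP=> e pP /andP[xp up].
have pP' := path_avoid y pP xp.
apply: (walk_cons e (walk_sub (subsetDl _ _) (IH _ _ _ pP' up))).
  by move=> f /setD1P[_ /l0].
by rewrite [leRHS](big_setD1 _ e).
Qed.

Lemma conn_of_walk F l y x r : (forall e, e \in F -> 0 <= l e) ->
  walk F l y x r ->
  exists A, [/\ A \subset F, connect (within A) x y & \sum_(e in A) l e <= r].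
Proof.
move=> l0; elim=> [s s0|u u' s s' e _ [A [AF c le]] le'].
  by exists set0; rewrite sub0set big_set0.
exists ([set u; u'] |: A); split.
- by rewrite subUset sub1set e.
- apply: connect_trans (connect1 _) (sub_conn (subsetUr _ _) c).
  by rewrite /within setU11.
- case: (boolP ([set u; u'] \in A)) => eA; last by rewrite big_setU1 //=; lra.
  have /setUidPr -> : [set [set u; u']] \subset A by rewrite sub1set.
  by have := l0 _ e; lra.
Qed.

Lemma path_walk F l x p : path (within F) x p ->
  walk F l (last x p) x (path_length l x p).
Proof.
elim: p x => [|y p IH] x; first by move=> _; apply: walk_nil; rewrite /path_length big_nil.
case/andP=> e pP; apply: walk_cons e (IH _ pP) _.
by rewrite /path_length /= big_cons.
Qed.

Lemma walk_path F l x y r : (forall e, e \in F -> 0 <= l e) -> walk F l y x r ->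
  exists p, [/\ path (within F) x p, uniq (x :: p), last x p = y
              & path_length l x p <= r].
Proof.
move=> l0; elim=> [s s0|u u' s s' e _ [p [pP up pl le]] le'].
  by exists [::]; rewrite /path_length big_nil.
case: (boolP (u \in u' :: p)) => up'; last first.
  exists (u' :: p); split => //=; rewrite ?[within _ _ _]e ?pP ?up' //.
  by rewrite /path_length /= big_cons; move: le; rewrite /path_length; lra.
(* A recurring vertex closes a loop; only the part of the path after the loop is kept, and
   nonnegative lengths make this no longer. *)
case/splitPl: up' pP up pl le => p1 p2 pl1.
rewrite cat_path last_cat pl1 -cat_cons cat_uniq => /andP[pP1 pP2] /and3P[up1 hp up2] pl le.
exists p2; split => //.
  rewrite /= up2 andbT; apply: contra hp => up; apply/hasP; exists u => //.
  by rewrite -pl1 mem_last.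
suff : path_length l u p2 <= s' by have := l0 _ e; lra.
move: le; rewrite /path_length pairmap_cat big_cat /= pl1; apply: le_trans.
rewrite lerDr; move: pP1.
elim: p1 {pl1 up1 hp le'} u' {e} => [|a p1 IH] b; first by rewrite big_nil.
by case/andP => ba pP1; rewrite /= big_cons addr_ge0 ?l0 ?IH.
Qed.

End Walks.

Section Distances.
Variables (R : realType) (V : finType).
Implicit Types (G : graph V) (l : {set V} -> R).

Lemma dist_le G l x y r : nonneg_lengths G l -> walk (edges G) l y x r ->
  (dist G l x y <= r%:E)%E.
Proof.
move=> l0 /(walk_path l0)[p [pP up pl le]].
apply: (@le_trans _ _ (path_length l x p)%:E); last by rewrite lee_fin.
by apply: ereal_inf_lbound; exists p.
Qed.

Lemma dist_lt G l x y r : (dist G l x y < r%:E)%E -> walk (edges G) l y x r.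
Proof.
move=> /ereal_inf_lt[_ [p [pP _ <-] <-]]; rewrite lte_fin => /ltW le.
exact: walk_le le (path_walk l pP).
Qed.

Lemma dist_ge G l x y r :
  (forall s, walk (edges G) l y x s -> r <= s) -> (r%:E <= dist G l x y)%E.
Proof.
move=> h; apply: le_ereal_inf_tmp => _ [p [pP _ pl] <-]; rewrite lee_fin.
by apply: h; rewrite -pl; apply: path_walk.
Qed.

Lemma eq_dist G G' l l' x y : nonneg_lengths G l -> nonneg_lengths G' l' ->
  (forall r, walk (edges G) l y x r <-> walk (edges G') l' y x r) ->
  dist G l x y = dist G' l' x y.
Proof.
move=> l0 l0' E; apply/le_anti/andP; split; apply: le_ereal_inf_tmp
    => _ [p [pP _ pl] <-]; apply: dist_le => //; apply/E; rewrite -pl;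
  exact: path_walk.
Qed.

End Distances.

(** * Regions of a tree decomposition *)

Lemma adj_verts (V : finType) (G : graph V) x y :
  adj G x y -> (x \in verts G) && (y \in verts G).
Proof.
move=> xy; have /andP[/subsetP s _] := forall_inP (edges_wf G) _ xy.
by rewrite !s // !inE eqxx ?orbT.
Qed.

Lemma adj_sym (V : finType) (G : graph V) : symmetric (adj G).
Proof. by move=> x y; rewrite /adj setUC. Qed.

Lemma connect_invariant (T : finType) (e : rel T) (P : pred T) x y :
  (forall a b, e a b -> P a -> P b) -> connect e x y -> P x -> P y.
Proof.
move=> h /connectP[p pP ->]; elim: p x pP => [|z p IH] x //= /andP[xz pP] Px.
exact: IH pP (h _ _ xz Px).
Qed.

Lemma rel_in_sym (V : finType) (G : graph V) (A : {set V}) :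
  symmetric [rel a b in A | adj G a b].
Proof. by move=> a b /=; rewrite adj_sym (andbC (a \in A)). Qed.

(** A path inside [W] between two distinct neighbours of [i] would close up through [i] to a
    cycle. *)
Lemma tree_unique_neighbor (I : finType) (T : graph I) (W : {set I}) i a b :
  is_tree T -> i \notin W -> connect [rel x y in W | adj T x y] a b ->
  a \in W -> adj T a i -> adj T b i -> a = b.
Proof.
case=> _ _ acyc iW /connectP[p0 p0P ->] aW ai bi {b}; apply/eqP.
case/shortenP: p0P bi => p pP up _ bi {p0}.
have pW : all (mem W) p.
  elim: p a {ai bi up aW} pP => //= y p IH a /andP[/andP[/andP[_ yW] _] pP].
  by rewrite [y \in W]yW (IH _ pP).
have pT : path (adj T) a p by apply: sub_path pP => x y /andP[].
case: p pW pT up bi {pP} => [|y p] // pW pT up bi.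
have : (size [:: i, a, y & p] <= 2)%N; last by [].
apply: acyc; apply/andP; split; last first.
  rewrite cons_uniq up andbT inE negb_or; apply/andP; split.
    by apply: contraNneq iW => ->.
  by apply: contra iW => ip; move/allP: pW; apply.
rewrite /= adj_sym ai /=; move: pT => /= /andP[-> pT] /=.
by rewrite rcons_path pT.
Qed.

(** [ok i W] says that [W] is a union of branches of the tree at the node [i], and [wt i W] counts
    the elements of [X] that occur in the bags of [W] but not in the bag of [i]. All nodes but one
    have weight at least 3q - q = 2q, so there is a pair (i, W) of weight at least 2q with [W] as
    small as possible. Minimality is what bounds its weight from above. *)
Lemma tree_separation (V I : finType) (G : graph V) (T : graph I)
    (B : I -> {set V}) (q : nat) (X : {set V}) :
  tree_decomposition G T B -> (forall i, i \in verts T -> #|B i| <= q)%N ->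
  X \subset verts G -> (0 < q)%N -> (3 * q <= #|X|)%N ->
  exists A1 A2 : {set V},
    [/\ verts G \subset A1 :|: A2,
        forall e, e \in edges G -> e \subset A1 \/ e \subset A2,
        (#|A1 :&: A2| <= q)%N &
        (2 * q <= #|X :&: (A1 :\: A2)| <= 4 * q)%N].
Proof.
move=> [treeT coverB edgeB connB] Bq XG q0 Xq.
pose U (W : {set I}) := \bigcup_(w in W) B w.
pose ok i (W : {set I}) := [&& i \in verts T, W \subset verts T :\ i
  & [forall a in W, forall b, adj T a b ==> (b \in W) || (b == i)]].
pose wt i W := #|X :&: (U W :\: B i)|.
have okP i W : ok i W -> [/\ i \in verts T, i \notin W, W \subset verts T &
    forall a b, a \in W -> adj T a b -> b \in W \/ b = i].
  case/and3P=> iT /subsetD1P[WT iW] /forall_inP h; split=> // a b aW ab.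
  by have /forallP/(_ b)/implyP/(_ ab)/orP[->|/eqP->] := h _ aW; [left|right].
have okI i (W : {set I}) : i \in verts T -> i \notin W -> W \subset verts T ->
    (forall a b, a \in W -> adj T a b -> b \in W \/ b = i) -> ok i W.
  move=> iT iW WT h; rewrite /ok iT subsetD1 WT iW /=.
  apply/forall_inP => a aW; apply/forallP => b; apply/implyP => ab.
  by case: (h _ _ aW ab) => ->; rewrite ?eqxx ?orbT.
have [i0 i0T] : exists i, i \in verts T.
  by case: treeT => /set0Pn.
have ok0 : ok i0 (verts T :\ i0) && (2 * q <= wt i0 (verts T :\ i0))%N.
  apply/andP; split.
    apply: okI => //; rewrite ?setD11 ?subsetDl // => a b _ /adj_verts/andP[_ bT].
    by rewrite !inE bT andbT; case: eqVneq; [right|left].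
  have : X \subset (X :&: (U (verts T :\ i0) :\: B i0)) :|: B i0.
    apply/subsetP => x xX; rewrite !inE xX /=; case: (boolP (x \in B i0)) => //= xi.
    have := subsetP XG _ xX; rewrite -coverB => /bigcupP[j jT xj].
    rewrite orbF; apply/bigcupP; exists j => //; rewrite !inE jT andbT.
    by apply: contraNneq xi => <-.
  move=> /subset_leq_card; rewrite cardsU /wt; move: (Bq _ i0T); lia.
case: (arg_minnP (fun iW : I * {set I} => #|iW.2|)
  (P := fun iW => ok iW.1 iW.2 && (2 * q <= wt iW.1 iW.2)%N)
  (i0 := (i0, verts T :\ i0)) ok0) => -[i W] /= /andP[okW wtW] minW.
have {}minW j W' : ok j W' -> (#|W'| < #|W|)%N -> (wt j W' < 2 * q)%N.
  move=> okW' ltW; rewrite ltnNge; apply/negP => le.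
  by have := minW (j, W'); rewrite /= okW' le => /(_ isT); rewrite leqNgt ltW.
have [iT iW WT Wcl] := okP _ _ okW.
(* The nodes whose bags contain a given vertex are connected, and [W] can only be left through
   [i]. *)
have capB : (U W :|: B i) :&: U (verts T :\: W) \subset B i.
  apply/subsetP => v; rewrite !inE => /andP[/orP[|//] /bigcupP[w wW vw]].
  move=> /bigcupP[z /setDP[zT zW] vz]; apply: contraNT zW => vi.
  have vG : v \in verts G.
    by rewrite -coverB; apply/bigcupP; exists w => //; apply: (subsetP WT).
  have := connB v vG w z; rewrite !inE vw vz zT (subsetP WT _ wW) => /(_ isT isT).
  move=> /connect_invariant; apply => // a b /= /andP[/andP[_]].
  rewrite !inE => /andP[_ vb] ab aW; case: (Wcl _ _ aW ab) => // bi.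
  by rewrite -bi vb in vi.
exists (U W :|: B i), (U (verts T :\: W)).
have D : (U W :|: B i) :\: U (verts T :\: W) = U W :\: B i.
  apply/setP => v; rewrite !inE; case: (boolP (v \in B i)) => vi /=.
    rewrite orbT andbT; apply/negbTE; rewrite negbK; apply/bigcupP.
    by exists i => //; rewrite !inE iT iW.
  rewrite orbF; case: (boolP (v \in U W)) => vW; rewrite ?andbF // andbT.
  apply: contra vi => v2; apply: (subsetP capB); rewrite inE v2 andbT.
  by rewrite inE vW.
split.
- apply/subsetP => v; rewrite -coverB => /bigcupP[j jT vj]; rewrite !inE.
  case: (boolP (j \in W)) => jW.
    by apply/orP; left; apply/orP; left; apply/bigcupP; exists j.
  by apply/orP; right; apply/bigcupP; exists j => //; rewrite inE jW.
- move=> e /edgeB[j jT ej]; case: (boolP (j \in W)) => jW; [left|right].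
    apply: (subset_trans ej); apply: subset_trans (subsetUl _ _).
    exact: (bigcup_max j).
  by apply: (subset_trans ej); apply: (bigcup_max j) => //; rewrite inE jW.
- exact: leq_trans (subset_leq_card capB) (Bq _ iT).
rewrite D -/(wt i W) wtW /=.
have [x xW] : exists x, x \in W.
  apply/set0Pn; apply: contraTneq wtW => W0.
  by rewrite /wt /U W0 big_set0 set0D setI0 cards0; lia.
pose eW := [rel a b in W | adj T a b].
have eWsym : connect_sym eW := sym_connect_sym (@rel_in_sym _ T W).
pose W1 := [set y in W | connect eW x y].
have W1W : W1 \subset W by apply/subsetP => y; rewrite inE => /andP[].
(* If [W] is disconnected, a component and the rest are both unions of branches at [i]. By
   minimality each weighs less than 2q, which gives the bound 4q. *)
have [W1E|W1E] := eqVneq W1 W; last first.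
  have xW1 : x \in W1 by rewrite inE xW connect0.
  have lt1 : (#|W1| < #|W|)%N by rewrite proper_card // properEneq W1E.
  have lt2 : (#|W :\: W1| < #|W|)%N.
    rewrite proper_card // properEneq subsetDl andbT.
    by apply/eqP => /setP/(_ x); rewrite in_setD xW1 xW.
  have ok1 : ok i W1.
    apply: okI => //; [by rewrite inE negb_and iW|exact: subset_trans WT|].
    move=> a b; rewrite inE => /andP[aW xa] ab.
    case: (Wcl _ _ aW ab) => [bW|->]; [left|by right].
    by rewrite inE bW (connect_trans xa) // connect1 //= aW bW.
  have ok2 : ok i (W :\: W1).
    apply: okI => //; [by rewrite inE negb_and iW orbT|
      exact: subset_trans (subsetDl _ _) WT|].
    move=> a b /setDP[aW aW1] ab.
    case: (Wcl _ _ aW ab) => [bW|->]; [left|by right].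
    rewrite in_setD bW andbT; apply: contra aW1; rewrite !inE aW bW /=.
    by move/connect_trans; apply; apply: connect1; rewrite /= bW aW adj_sym.
  have := minW _ _ ok1 lt1; have := minW _ _ ok2 lt2.
  suff le : (wt i W <= wt i W1 + wt i (W :\: W1))%N.
    move=> lt2' lt1'; apply: leq_trans le _.
    by rewrite -[4%N]/(2 + 2)%N mulnDl leq_add // ltnW.
  apply: leq_trans (leq_card_setU _ _); apply: subset_leq_card.
  apply/subsetP => v; rewrite !inE => /and3P[-> -> /bigcupP[w wW vw]] /=.
  case: (boolP (w \in W1)) => wW1.
    by apply/orP; left; apply/bigcupP; exists w.
  by apply/orP; right; apply/bigcupP; exists w => //; rewrite inE wW1.
have eWc a b : a \in W -> b \in W -> connect eW a b.
  rewrite -{1 2}W1E !inE => /andP[_ xa] /andP[_ xb].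
  by apply: connect_trans xb; rewrite eWsym.
(* If [W] is connected, move from [i] to its only neighbour [j] in [W]. The pair (j, W minus j)
   weighs less than 2q, and the move loses at most the q vertices of the bag of [j]. If [i] has no
   neighbour in [W], any node of [W] serves as [j]. *)
have [j jW jU] : exists2 j, j \in W & forall a, a \in W -> adj T a i -> a = j.
  case: (pickP [pred j in W | adj T j i]) => [j /andP[/= jW ji]|no].
    exists j => // a aW ai.
    exact: (tree_unique_neighbor treeT iW (eWc _ _ aW jW)).
  by exists x => // a aW ai; have := no a; rewrite /= aW ai.
have okj : ok j (W :\ j).
  apply: okI; rewrite ?setD11 ?(subsetP WT) //.
    exact: subset_trans (subsetDl _ _) WT.
  move=> a b /setD1P[aj aW] ab; case: (Wcl _ _ aW ab) => [bW|bi].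
    by rewrite !inE bW andbT; case: eqVneq; [right|left].
  by case/eqP: aj; apply: jU; rewrite -?bi.
have := minW _ _ okj; rewrite (cardsD1 j W) jW => /(_ (leqnn _)).
have := Bq _ (subsetP WT _ jW).
suff le : (wt i W <= wt j (W :\ j) + #|B j|)%N.
  move=> Bj /ltnW ltj; apply: leq_trans le (leq_trans (leq_add ltj Bj) _).
  by rewrite -mulSnr leq_mul2r orbT.
apply: leq_trans (leq_card_setU _ _); apply: subset_leq_card.
apply/subsetP => v; rewrite !inE => /and3P[-> _ /bigcupP[w wW vw]] /=.
case: (boolP (v \in B j)) => //= vj; rewrite ?orbT // orbF.
apply/bigcupP; exists w => //; rewrite !inE wW andbT.
by apply: contraNneq vj => <-.
Qed.

(* A region (A, Q) is a vertex set A with the set Q of its terminals. *)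
Lemma region_decomposition (V I : finType) (G : graph V) (T : graph I)
    (B : I -> {set V}) (q : nat) (A X : {set V}) :
  tree_decomposition G T B -> (forall i, i \in verts T -> #|B i| <= q)%N ->
  (0 < q)%N -> A \subset verts G -> X \subset A ->
  exists rs : seq ({set V} * {set V}),
    [/\ (size rs * q <= #|X| + q)%N,
        forall e, e \in edges G -> e \subset A -> exists2 r, r \in rs & e \subset r.1,
        A \subset \bigcup_(r <- rs) r.1,
        forall r, r \in rs ->
          [/\ r.1 \subset A, r.2 \subset r.1, (#|r.2| <= 5 * q)%N &
              X :&: r.1 \subset r.2] &
        {in rs &, forall r s, r != s -> r.1 :&: s.1 \subset r.2 :&: s.2}].
Proof.
move=> TB Bq q0; have [n] := ubnP #|X|; elim: n A X => // n IH A X Xn AG XA.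
have [X5|X5] := leqP #|X| (5 * q)%N.
  exists [:: (A, X)]; split => /=.
  - lia.
  - by move=> e _ eA; exists (A, X); rewrite ?inE.
  - by rewrite big_seq1.
  - by move=> r; rewrite inE => /eqP -> /=; split => //; apply: subsetIl.
  - by move=> r s; rewrite !inE => /eqP-> /eqP->; rewrite eqxx.
have XG := subset_trans XA AG.
(* The separation is that of the whole graph, applied to the terminals left in [A], so that one tree
   decomposition serves for all cuts. *)
have [|A1 [A2 [cov edg capq /andP[lo hi]]]] := tree_separation TB Bq XG q0; first by lia.
set C := A1 :&: A2 in capq.
(* Separator vertices become terminals on both sides. The remaining part loses at least 2q terminals
   and gains at most q; the net loss of q pays for one region. *)
pose X2 := (X :&: A2) :|: (C :&: A).
have cX2 : (#|X2| + q <= #|X|)%N.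
  have : X2 \subset (X :\: (X :&: (A1 :\: A2))) :|: C.
    apply/subsetP => v; rewrite !inE.
    by case: (v \in X); case: (v \in A1); case: (v \in A2); rewrite ?andbF.
  move=> /subset_leq_card; rewrite cardsU cardsDS ?subsetIl // => h.
  by move: h lo capq; lia.
have [|||rs [szrs edgrs covrs proprs caprs]] := IH (A :&: A2) X2.
- lia.
- exact: subset_trans (subsetIl _ _) AG.
- apply/subsetP => v; rewrite !inE => /orP[/andP[vX ->]|/andP[/andP[_ ->] ->]] //.
  by rewrite (subsetP XA).
(* At most 4q old terminals and q separator vertices: this is the bound 5q. *)
pose r0 := (A :&: A1, (X :&: A1) :|: (C :&: A)).
have r0cap s : s \in rs -> r0.1 :&: s.1 \subset r0.2 :&: s.2.
  move=> /proprs[sA _ _ Xs]; apply/subsetP => v; rewrite !inE /=.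
  case/andP => /andP[vA vA1] vs; move: (subsetP sA _ vs); rewrite inE => /andP[_ vA2].
  rewrite vA vA1 vA2 /= orbT /=; apply: (subsetP Xs); rewrite inE vs andbT.
  by rewrite !inE vA vA1 vA2 orbT.
exists (r0 :: rs); split => /=.
- move: szrs cX2; lia.
- move=> e eG eA; have [e1|e2] := edg _ eG.
    by exists r0; rewrite ?mem_head // subsetI eA.
  have [|r rrs er] := edgrs e eG; first by rewrite subsetI eA.
  by exists r => //; rewrite inE rrs orbT.
- rewrite big_cons; apply/subsetP => v vA.
  have := subsetP cov _ (subsetP AG _ vA); rewrite !inE vA => /orP[->//|v2].
  by rewrite (subsetP covrs) ?orbT // inE vA.
- move=> r; rewrite inE => /orP[/eqP->|/proprs[rA rr rq Xr]] /=.
    split; [exact: subsetIl| | |].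
      rewrite /r0 /=; apply/subsetP => v; rewrite !inE.
      case/orP=> [/andP[vX ->]|/andP[/andP[-> _] ->]] //.
      by rewrite (subsetP XA).
      have : (X :&: A1) :|: (C :&: A) \subset (X :&: (A1 :\: A2)) :|: C.
        apply/subsetP => v; rewrite !inE.
        by case: (v \in X); case: (v \in A1); case: (v \in A2); rewrite ?andbF.
      move=> /subset_leq_card; rewrite (cardsU (X :&: (A1 :\: A2))) => h.
      by move: h hi capq; lia.
    by rewrite /r0 /=; apply/subsetP => v; rewrite !inE => /and3P[-> _ ->].
  split => //; first exact: subset_trans rA (subsetIl _ _).
  apply: subset_trans Xr; apply/subsetP => v; rewrite !inE => /andP[vX vr].
  have := subsetP rA _ vr; rewrite inE => /andP[_ ->].
  by rewrite vX vr.
- move=> r s; rewrite !inE => /orP[/eqP->|rrs] /orP[/eqP->|srs] rs_.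
  + by rewrite eqxx in rs_.
  + exact: r0cap.
  + by rewrite setIC (setIC r.2); apply: r0cap.
  + exact: caprs.
Qed.

(** * Shortest paths under generic weights *)

Lemma binary_digits_inj n (f g : nat -> bool) :
  (\sum_(i < n) f i * 2 ^ i = \sum_(i < n) g i * 2 ^ i)%N ->
  forall i, (i < n)%N -> f i = g i.
Proof.
elim: n f g => [|n IH] f g; first by move=> _ [].
have shift (h : nat -> bool) : (\sum_(i < n.+1) h i * 2 ^ i =
    h 0%N + (\sum_(i < n) h i.+1 * 2 ^ i).*2)%N.
  rewrite big_ord_recl /= muln1 -mul2n big_distrr /=; congr (_ + _)%N.
  by apply: eq_bigr => i _; rewrite expnS mulnCA.
rewrite !shift => E.
have E0 : f 0%N = g 0%N.
  by have := congr1 odd E; rewrite !oddD !odd_double !addbF !oddb.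
case=> [|i] // lt_in; apply: (IH (f \o succn) (g \o succn)) => //=.
by move: E; rewrite E0 => /addnI/double_inj.
Qed.

Lemma exists_gap (R : realType) (T : finType) (f : T -> R) :
  exists2 g, 0 < g & forall t, 0 < f t -> g <= f t.
Proof.
have [s] : {s : seq T | enum T = s} by exists (enum T).
move=> Es; suff [g g0 gP] : exists2 g, 0 < g & {in s, forall t, 0 < f t -> g <= f t}.
  by exists g => // t; apply: gP; rewrite -Es mem_enum.
elim: s {Es} => [|t s [g g0 gP]]; first by exists 1.
case: (ltrP 0 (f t)) => ft.
  exists (Num.min g (f t)); first by rewrite lt_min g0.
  move=> u; rewrite inE => /predU1P[-> _|us fu]; first by rewrite ge_min lexx orbT.
  by rewrite ge_min gP.
exists g => // u; rewrite inE => /predU1P[-> /lt_geF|]; last exact: gP.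
by rewrite ft.
Qed.

(* Add a tiny multiple of 2^i to the length of the i-th edge. *)
Lemma generic_weights (R : realType) (T : finType) (l : T -> R) :
  exists w : T -> R, [/\ forall e, l e < w e,
    forall A B : {set T}, \sum_(e in A) w e = \sum_(e in B) w e -> A = B &
    forall A B : {set T}, \sum_(e in A) w e <= \sum_(e in B) w e ->
      \sum_(e in A) l e <= \sum_(e in B) l e].
Proof.
pose L (A : {set T}) := \sum_(e in A) l e.
pose b (A : {set T}) := (\sum_(e in A) 2 ^ enum_rank e)%N.
have [g g0 gP] := exists_gap (fun AB : {set T} * {set T} => L AB.1 - L AB.2).
(* [g] is at most every positive difference between the lengths of two edge sets. With this factor
   the whole perturbation of any edge set stays below [g], so no strict comparison is reversed. *)
pose d := g / (b setT).+1%:R.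
have d0 : 0 < d by rewrite divr_gt0 // ltr0n.
have dg (A : {set T}) : d * (b A)%:R < g.
  rewrite /d mulrAC ltr_pdivrMr ?ltr0n // ltr_pM2l // ltr_nat ltnS /b [leqRHS](big_setID A) /=.
  by rewrite setTI leq_addr.
exists (fun e => l e + d * (2 ^ enum_rank e)%N%:R).
have wE (A : {set T}) :
    \sum_(e in A) (l e + d * (2 ^ enum_rank e)%N%:R) = L A + d * (b A)%:R.
  by rewrite big_split /= -mulr_sumr -natr_sum.
have mono (A B : {set T}) : L A + d * (b A)%:R <= L B + d * (b B)%:R -> L A <= L B.
  move=> le; rewrite leNgt; apply/negP => lt.
  have := gP (A, B); rewrite /= subr_gt0 => /(_ lt).
  by have := dg B; have := mulr_ge0 (ltW d0) (ler0n R (b A)); lra.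
split; last by move=> A B; rewrite !wE; apply: mono.
  by move=> e; rewrite ltrDl mulr_gt0 // ltr0n expn_gt0.
move=> A B; rewrite !wE => E.
have LE : L A = L B by apply/le_anti; rewrite !mono ?E.
have /eqP : d * (b A)%:R = d * (b B)%:R by lra.
rewrite (inj_eq (mulfI (lt0r_neq0 d0))) eqr_nat => /eqP bE.
have bD (C : {set T}) :
    b C = (\sum_(i < #|T|) (nth false [seq e \in C | e <- enum T] i) * 2 ^ i)%N.
  rewrite /b (reindex (@enum_val T T)) /=; last exact/onW_bij/enum_val_bij.
  rewrite big_mkcond; apply: eq_bigr => i _; rewrite enum_valK.
  rewrite (nth_map (enum_val i)) -?cardE // -(enum_val_nth (enum_val i)).
  by case: (_ \in C); rewrite ?mul1n.
move: bE; rewrite !bD => /binary_digits_inj digits; apply/setP => e.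
have := digits (enum_rank e) (ltn_ord _).
by rewrite !(nth_map e) -?enumT -?cardE // nth_enum_rank.
Qed.

Section GenericMetric.
Variables (R : realType) (V : finType) (E : {set {set V}}) (w : {set V} -> R).
Hypothesis w0 : forall e, e \in E -> 0 < w e.
Hypothesis w_inj : forall A B : {set {set V}},
  \sum_(e in A) w e = \sum_(e in B) w e -> A = B.
Implicit Types (A B : {set {set V}}) (a b c u v x y z t : V).

Let weight A := \sum_(e in A) w e.
Let joins x y A := (A \subset E) && connect (within A) x y.

Let top := weight E + 1.

(* The distance for w, and [top] between vertices that are not connected; a
   sentinel keeps all distances in R and the triangle inequality true. *)
Definition gdist x y : R := \big[Num.min/top]_(A | joins x y A) weight A.
Local Notation d := gdist.

Lemma weight_ge0 A : A \subset E -> 0 <= weight A.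
Proof. by move=> /subsetP AE; apply: sumr_ge0 => e /AE/w0/ltW. Qed.

Lemma weightS A B : A \subset B -> B \subset E -> weight A <= weight B.
Proof.
move=> AB BE; rewrite /weight [leRHS](big_setID A) /= (setIidPr AB) lerDl.
by apply: weight_ge0; apply: subset_trans (subsetDl _ _) BE.
Qed.

Lemma weightU A B : A \subset E -> B \subset E -> weight (A :|: B) <= weight A + weight B.
Proof.
move=> AE BE; rewrite /weight (big_setID A) /= setUK lerD2l.
by rewrite setDUl setDv set0U weightS // subsetDl.
Qed.

Lemma gdist_le A x y : A \subset E -> connect (within A) x y -> d x y <= weight A.
Proof. by move=> AE c; apply: bigmin_le_cond; rewrite /joins AE. Qed.

Lemma gdist_le_top x y : d x y <= top.
Proof. exact: bigmin_le_id. Qed.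

Lemma gdistP x y : d x y = top \/
  exists A, [/\ A \subset E, connect (within A) x y & d x y = weight A].
Proof.
rewrite /gdist; elim/big_ind: _ => [|a b|A /andP[AE c]].
- by left.
- by rewrite /Num.min; case: ifP.
- by right; exists A.
Qed.

Lemma gdist_fin x y : (d x y < top) = connect (within E) x y.
Proof.
apply/idP/idP => [|c].
  case: (gdistP x y) => [->|[A [AE c _] _]]; first by rewrite ltxx.
  exact: sub_conn AE c.
by apply: le_lt_trans (gdist_le (subxx E) c) _; rewrite ltrDl.
Qed.

Lemma gdist_min x y : connect (within E) x y ->
  exists A, [/\ A \subset E, connect (within A) x y & d x y = weight A].
Proof. by rewrite -gdist_fin; case: (gdistP x y) => // ->; rewrite ltxx. Qed.

Lemma gdist_ge0 x y : 0 <= d x y.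
Proof.
case: (gdistP x y) => [->|[A [AE _ ->]]]; last exact: weight_ge0.
by rewrite addr_ge0 // weight_ge0.
Qed.

Lemma gdistxx x : d x x = 0.
Proof.
apply/le_anti; rewrite gdist_ge0 andbT.
by apply: le_trans (gdist_le (sub0set _) (connect0 _ _)) _; rewrite /weight big_set0.
Qed.

Lemma gdistC x y : d x y = d y x.
Proof. by rewrite /gdist; apply: eq_bigl => A; rewrite /joins conn_sym. Qed.

Lemma gdist_triangle x y z : d x z <= d x y + d y z.
Proof.
have top_le := gdist_le_top x z.
case: (gdistP x y) => [->|[A [AE cA ->]]]; first by have := gdist_ge0 y z; lra.
case: (gdistP y z) => [->|[B [BE cB ->]]]; first by have := weight_ge0 AE; lra.
apply: le_trans (weightU AE BE); apply: gdist_le; first by rewrite subUset AE.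
apply: connect_trans (sub_conn (subsetUl _ _) cA) (sub_conn (subsetUr _ _) cB).
Qed.

Lemma gdist_edge x a v : [set x; a] \in E -> d x v <= w [set x; a] + d a v.
Proof.
move=> xa; apply: le_trans (gdist_triangle x a v) _; rewrite lerD2r.
apply: le_trans (gdist_le (A := [set [set x; a]]) _ _) _.
- by rewrite sub1set.
- by apply: connect1; rewrite /within inE.
- by rewrite /weight big_set1.
Qed.

(** Shortest paths are not built as sequences. When [x] and [v] are connected, [next x v a] says
    that some shortest path from [x] to [v] starts with the edge to [a]; likewise [between] says
    that [z] lies on a shortest path. *)
Definition next x v a :=
  ([set x; a] \in E) && (d x v == w [set x; a] + d a v).

Definition between u z v := d u z + d z v == d u v.

Lemma next_fin x v a : connect (within E) x v -> next x v a -> connect (within E) a v.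
Proof.
move=> c /andP[xa _]; apply: connect_trans c; apply: connect1.
by rewrite within_sym.
Qed.

Lemma next_ex x v : connect (within E) x v -> x != v -> exists a, next x v a.
Proof.
move=> /gdist_min[A [AE c dE]] xv.
case/connectP: c => p0 p0P; case/shortenP: p0P => -[|a p] /= pP up _ vE {p0}.
  by rewrite vE eqxx in xv.
case/andP: pP => xa pP; exists a; rewrite /next (subsetP AE) //=.
apply/eqP/le_anti/andP; split; first by apply/gdist_edge/(subsetP AE).
rewrite dE /weight (big_setD1 _ xa) /= lerD2l; apply: gdist_le.
  exact: subset_trans (subsetDl _ _) AE.
by apply/connectP; exists p; first by case/andP: up => /(path_avoid a pP).
Qed.

(* A minimal edge set joining x to v through a first edge xa is the edge xa
   together with a minimal set joining a to v; by genericity it is the same for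
   another first edge xb, which would then be usable after a. *)
Lemma next_uniq x v a b : connect (within E) x v -> next x v a -> next x v b -> a = b.
Proof.
move=> c; have span z : next x v z -> exists A, [/\ A \subset E,
    connect (within A) z v, d z v = weight A, [set x; z] \notin A &
    weight ([set x; z] |: A) = d x v].
  move=> nz; have [A [AE cA dA]] := gdist_min (next_fin c nz).
  have /andP[xz /eqP dx] := nz.
  have xzA : [set x; z] \notin A.
    apply/negP => xzA.
    have := gdist_le AE (connect_trans (connect1 (xzA : within A x z)) cA).
    by rewrite dx dA; have := w0 xz; lra.
  by exists A; split=> //; rewrite /weight big_setU1 //= dx dA.
move=> na nb; have [A [AE cA dA xaA wA]] := span _ na.
have [B [BE cB dB xbB wB]] := span _ nb.
have AB : [set x; a] |: A = [set x; b] |: B by apply: w_inj; rewrite [LHS]wA.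
have [//|ab] := eqVneq a b; exfalso.
have xb_neq : [set x; b] != [set x; a].
  apply: contra ab => /eqP/setP e.
  have xx : [set x; a] \in E by case/andP: na.
  have := e a; have := e b; rewrite !inE !eqxx !orbT eq_sym => /esym.
  case/orP => [/eqP xb|]; last by rewrite eq_sym.
  by rewrite -xb orbb eq_sym => ->.
have xbA : [set x; b] \in A.
  have : [set x; b] \in [set x; a] |: A by rewrite AB setU11.
  by rewrite in_setU1 (negbTE xb_neq).
have/andP[xa /eqP dx] := na.
case/connectP: cA => p0 p0P; case/shortenP: p0P => p pP up _ vE {p0}.
case: (boolP (x \in a :: p)) => [xp|xp].
  have : connect (within A) x v.
    case/splitPl: xp pP vE {up} => p1 p2 pl.
    rewrite cat_path last_cat pl => /andP[_ p2P] ->.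
    by apply/connectP; exists p2.
  by move=> /(gdist_le AE); rewrite dx dA; have := w0 xa; lra.
have : d a v <= weight (A :\ [set x; b]).
  apply: gdist_le; first exact: subset_trans (subsetDl _ _) AE.
  by apply/connectP; exists p; first exact: path_avoid.
by rewrite dA /weight (big_setD1 _ xbA) /=; have := w0 (subsetP AE _ xbA); lra.
Qed.

Lemma betweenC u z v : between u z v = between v z u.
Proof. by rewrite /between addrC [d u v]gdistC [d u z]gdistC [d z v]gdistC. Qed.

Lemma between_fin u z v : connect (within E) u v -> between u z v ->
  connect (within E) u z /\ connect (within E) z v.
Proof.
rewrite -!gdist_fin => lt /eqP e.
by have := gdist_ge0 u z; have := gdist_ge0 z v; split; lra.
Qed.

Lemma next_between u z v a : connect (within E) u v -> between u z v ->
  next u z a -> next u v a /\ between a z v.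
Proof.
move=> c /eqP uzv /andP[ua /eqP uz].
have := gdist_edge v ua; have := gdist_triangle a z v => h1 h2.
by split; [apply/andP; split=> //|]; apply/eqP; lra.
Qed.

(** The first step towards [x] and the first step towards [y] are both first steps towards [v], so
    they agree by uniqueness. Taking this step leaves fewer vertices nearer to [v]. *)
Lemma between_total u v x y : connect (within E) u v ->
  between u x v -> between u y v -> between u x y \/ between u y x.
Proof.
have [n] := ubnP #|[set z | d z v < d u v]|.
elim: n u => // n IH u un c ux uy.
have [cx _] := between_fin c ux; have [cy _] := between_fin c uy.
have [->|xu] := eqVneq u x; first by left; rewrite /between gdistxx add0r.
have [->|yu] := eqVneq u y; first by right; rewrite /between gdistxx add0r.
have [a na] := next_ex cx xu; have [b nb] := next_ex cy yu.
have [na' ax] := next_between c ux na; have [nb' by_] := next_between c uy nb.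
have ab := next_uniq c na' nb'; rewrite -{b}ab in nb nb' by_ *.
have /andP[ua /eqP da] := na'; have a0 := w0 ua.
have lt : (#|[set z | (d z v < d a v)%R]| < n)%N.
  apply: leq_trans (_ : #|[set z | (d z v < d u v)%R]| <= n)%N; last by [].
  apply: proper_card; rewrite properE; apply/andP; split.
    by apply/subsetP => z; rewrite !inE; lra.
  by apply/subsetPn; exists a; rewrite !inE ?ltxx //; lra.
have /andP[_ /eqP dx] := na; have /andP[_ /eqP dy] := nb.
have := IH a lt (next_fin c na') ax by_; rewrite /between => -[] /eqP e;
  [left|right]; apply/eqP/le_anti; rewrite gdist_triangle andbT; lra.
Qed.

Lemma between_trans u x y v :
  between u x y -> between u y v -> between u x v /\ between x y v.
Proof.
move=> /eqP h1 /eqP h2; have := gdist_triangle x y v.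
have := gdist_triangle u x v; rewrite /between => h3 h4.
by split; apply/eqP; lra.
Qed.

(** The shortest path from u' to v' leaves that from u to v at [z], on its way to v'. Leaving it in
    the other direction is the same notion with u' and v' exchanged. *)
Definition branching u v u' v' z := between u z v && between u' z v' &&
  [exists c, [&& next z v' c, ~~ next z u c & ~~ next z v c]].

(** Two shortest paths that share x, y and z share the edges at [y] leading to [x] and to [z]. If
    either leads towards v', it is the step that was supposed to leave the first path. Otherwise
    both lead towards u', hence coincide, and the first path would turn back at [y]. *)
Lemma middle_not_branching u v u' v' x y z :
  connect (within E) u v -> connect (within E) u' v' ->
  x != y -> z != y -> between u x y -> between u y z -> between u z v ->
  between u' x v' -> between u' z v' -> ~~ branching u v u' v' y.
Proof.
move=> c c' xy zy uxy uyz uzv x' z'; apply/negP.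
case/andP => /andP[_ y'] /existsP[e /and3P[ne nu nv]].
have [uyv yzv] := between_trans uyz uzv.
have [cu cv] := between_fin c uyv.
have [cu' cv'] := between_fin c' y'.
have [cux cxy] := between_fin cu uxy.
have [cyz _] := between_fin cv yzv.
rewrite conn_sym in cu; rewrite conn_sym in cu'; rewrite conn_sym in cxy.
rewrite eq_sym in xy; rewrite eq_sym in zy.
have [a na] := next_ex cxy xy; have [b nb] := next_ex cyz zy.
have [nua _] : next y u a /\ between a x u by apply: next_between cu _ na; rewrite betweenC.
have [nvb _] := next_between cv yzv nb.
have toward t g : between u' t v' -> next y t g -> next y u' g \/ next y v' g.
  move=> t' ng; case: (between_total c' t' y') => h.
    by left; apply: (proj1 (next_between cu' _ ng)); rewrite betweenC.
  right; have [_ h'] := between_trans h t'.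
  exact: (proj1 (next_between cv' h' ng)).
have nv'a : next y u' a.
  case: (toward _ _ x' na) => // h; have ea := next_uniq cv' h ne.
  by rewrite -ea nua in nu.
have nv'b : next y u' b.
  case: (toward _ _ z' nb) => // h; have eb := next_uniq cv' h ne.
  by rewrite -eb nvb in nv.
have ab := next_uniq cu' nv'a nv'b; rewrite -ab in nvb.
move: nua nvb => /andP[ya /eqP d1] /andP[_ /eqP d2].
move: uyv => /eqP; have := gdist_triangle u a v.
by rewrite (gdistC u a) (gdistC u y); have := w0 ya; lra.
Qed.

(** Among three vertices of the first path, one lies between the other two. *)
Lemma card_branching u v u' v' :
  connect (within E) u v -> connect (within E) u' v' ->
  (#|[set z | branching u v u' v' z]| <= 2)%N.
Proof.
move=> c c'; rewrite leqNgt; apply/negP => /card_gt2P[x [y [z [[]]]]].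
rewrite !inE => bx by_ bz [xy yz zx].
have tot s t : branching u v u' v' s -> branching u v u' v' t ->
    between u s t \/ between u t s.
  by move=> /andP[/andP[hs _] _] /andP[/andP[ht _] _]; apply: between_total c _ _.
have mid p q r : branching u v u' v' p -> branching u v u' v' q ->
    branching u v u' v' r -> p != q -> r != q -> between u p q -> between u q r -> False.
  move=> /andP[/andP[_ p'] _] bq /andP[/andP[hr r'] _] pq rq h1 h2.
  by have := middle_not_branching c c' pq rq h1 h2 hr p' r'; rewrite bq.
have yx : y != x by rewrite eq_sym.
have zy : z != y by rewrite eq_sym.
have xz : x != z by rewrite eq_sym.
case: (tot x y bx by_) => h1; case: (tot y z by_ bz) => h2;
  case: (tot x z bx bz) => h3; first [exact: (mid x y z)|exact: (mid x z y)|
  exact: (mid y x z)|exact: (mid y z x)|exact: (mid z x y)|exact: (mid z y x)].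
Qed.

End GenericMetric.

Lemma leq_card_bigcup (I : Type) (T : finType) (r : seq I) (P : pred I) (F : I -> {set T}) :
  (#|\bigcup_(i <- r | P i) F i| <= \sum_(i <- r | P i) #|F i|)%N.
Proof.
elim/big_rec2: _ => [|i n A _ le]; first by rewrite cards0.
exact: leq_trans (leq_card_setU _ _) (leq_add (leqnn _) le).
Qed.

Lemma eq_set2 (T : finType) (a b c d : T) :
  [set a; b] = [set c; d] -> (a = c /\ b = d) \/ (a = d /\ b = c).
Proof.
move=> e; have : a \in [set c; d] by rewrite -e set21.
rewrite !inE => /orP[]/eqP ac; [left|right]; split=> //; apply/eqP.
  have : b \in [set c; d] by rewrite -e set22.
  have : d \in [set a; b] by rewrite e set22.
  by rewrite !inE ac => /orP[] /eqP -> // /orP[] /eqP ->.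
have : b \in [set c; d] by rewrite -e set22.
have : c \in [set a; b] by rewrite e set21.
by rewrite !inE ac => /orP[] /eqP -> // /orP[] /eqP ->.
Qed.

(** * Sparse subgraphs that preserve terminal distances *)

Definition nbr (V : finType) (F : {set {set V}}) (z : V) := [set a | [set z; a] \in F].

(* With generic weights, the union of the shortest paths between terminals
   branches at most twice for each pair of these paths. *)
Lemma sparse_preserver (R : realType) (V : finType) (E : {set {set V}})
    (Q : {set V}) (l : {set V} -> R) : (forall e, e \in E -> 0 <= l e) ->
  exists F : {set {set V}}, [/\ F \subset E,
    {in Q &, forall u v r, walk E l v u r -> walk F l v u r} &
    (#|[set z | z \notin Q & 2 < #|nbr F z|]| <= 2 * #|Q| ^ 4)%N].
Proof.
move=> l0; have [w [lw w_inj w_le]] := generic_weights l.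
have w0 e : e \in E -> 0 < w e by move=> /l0/le_lt_trans; apply.
have w0' e : e \in E -> 0 <= w e by move=> /w0/ltW.
pose d := gdist E w.
(* A shortest path from [u] to [v] traverses the edge from [a] to [b]. *)
pose geo u v a b := connect (within E) u v && (d u a + w [set a; b] + d b v == d u v).
pose F := [set e in E | [exists u in Q, exists v in Q, exists a, exists b,
  (e == [set a; b]) && geo u v a b]].
have FE : F \subset E by apply/subsetP => e; rewrite inE => /andP[].
have Fgeo u v a b : u \in Q -> v \in Q -> [set a; b] \in E -> geo u v a b ->
    [set a; b] \in F.
  move=> uQ vQ ab g; rewrite inE ab /=; apply/existsP; exists u; rewrite uQ /=.
  apply/existsP; exists v; rewrite vQ /=; apply/existsP; exists a.
  by apply/existsP; exists b; rewrite eqxx.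
exists F; split=> //.
  move=> u v uQ vQ r uv; have c := walk_conn uv.
  have wF x : between E w u x v -> walk F w v x (d x v).
    have [n] := ubnP #|[set z | (d z v < d x v)%R]|.
    elim: n x => // n IH x xn ux; have [ucx xcv] := between_fin w0 c ux.
    have [->|xv] := eqVneq x v; first by apply: walk_nil; apply: gdist_ge0.
    have [a /andP[xa /eqP da]] := next_ex w0 xcv xv; have a0 := w0 _ xa.
    have := gdist_edge w0 u (etrans (congr1 _ (setUC _ _)) xa : [set a; x] \in E).
    rewrite (setUC [set a]) -[gdist E w a u]gdistC -[gdist E w x u]gdistC => ha.
    have tri := gdist_triangle w0 u a v.
    move/eqP: (ux) => ux_; rewrite -/d in da ha tri ux_.
    apply: (walk_cons (Fgeo u v x a uQ vQ xa _) (IH a _ _)); last by rewrite -da.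
    - by rewrite /geo c; apply/eqP; lra.
    - apply: leq_trans (_ : #|[set z | (d z v < d x v)%R]| <= n)%N; last by [].
      apply: proper_card; rewrite properE; apply/andP; split.
        by apply/subsetP => z; rewrite !inE; lra.
      by apply/subsetPn; exists a; rewrite !inE ?ltxx //; lra.
    - by apply/eqP; rewrite -/d; lra.
  have uu : between E w u u v by rewrite /between (gdistxx w0) add0r.
  (* The walk along [F] is shortest for [w] only. Both it and the given walk are turned into edge
     sets, since a comparison of their sums for [w] implies the same comparison for [l]. *)
  have [A [AF cA wA]] := conn_of_walk (fun e eF => w0' e (subsetP FE e eF)) (wF u uu).
  have [B [BE cB lB]] := conn_of_walk l0 uv.
  have lA : \sum_(e in A) l e <= r.
    by apply: le_trans (w_le _ _ _) lB; apply: le_trans wA (gdist_le w BE cB).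
  apply: walk_le lA (walk_sub AF (walk_of_conn _ cA)).
  by move=> e /(subsetP AF)/(subsetP FE)/l0.
pose br (q : V * V * V * V) :=
  if connect (within E) q.1.1.1 q.1.1.2 && connect (within E) q.1.2 q.2 then
  [set z | branching E w q.1.1.1 q.1.1.2 q.1.2 q.2 z] else set0.
pose QQ := setX (setX (setX Q Q) Q) Q.
have brc q : (#|br q| <= 2)%N.
  rewrite /br; case: ifP => [/andP[c c']|_]; last by rewrite cards0.
  exact: card_branching w0 w_inj _ _ _ _ c c'.
have -> : (2 * #|Q| ^ 4 = \sum_(q in QQ) 2)%N.
  by rewrite sum_nat_const !cardsX !expnS expn0; lia.
apply: leq_trans (_ : \sum_(q in QQ) #|br q| <= _)%N; last exact: leq_sum.
apply: leq_trans (leq_card_bigcup _ _ _); apply: subset_leq_card.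
(* The two ends are exchanged if necessary, so that [a] comes after [z] on the way to [v]. *)
have Fnext z a : z \notin Q -> [set z; a] \in F -> exists u v,
    [/\ u \in Q, v \in Q, connect (within E) u v, between E w u z v & next E w z v a].
  move=> zQ; rewrite inE => /andP[za /existsP[u /andP[uQ /existsP[v /andP[vQ]]]]].
  case/existsP=> b1 /existsP[b2 /andP[/eqP e /andP[c /eqP g]]].
  have h1 := gdist_edge w0 v za.
  have h2 := gdist_triangle w0 u z v; rewrite -/d in h1 h2.
  have h3 := gdist_edge w0 u za.
  have h4 := gdist_triangle w0 v z u; rewrite -/d in h3 h4.
  case: (eq_set2 e) => -[E1 E2]; subst b1 b2.
    by exists u, v; split=> //; [|apply/andP; split=> //]; apply/eqP; rewrite -/d; lra.
  exists v, u; rewrite conn_sym c; rewrite setUC in g.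
  move: g h4; rewrite [d v u]gdistC [d u a]gdistC [d z v]gdistC => g h4.
  rewrite -/d in g h4.
  by split=> //; [|apply/andP; split=> //]; apply/eqP; rewrite -/d ?[d v u]gdistC -/d; lra.
apply/subsetP => z; rewrite inE => /andP[zQ deg].
(* The path through the edge to [a] uses one more edge at [z], to [b]. A third neighbour [e] belongs
   to another path, which therefore branches off at [z]. *)
have [a] : exists a, a \in nbr F z.
  by apply/set0Pn; rewrite -card_gt0; apply: leq_trans deg.
rewrite inE => /(Fnext _ _ zQ)[u [v [uQ vQ c uzv nva]]].
have zu : z != u by apply: contraNneq zQ => ->.
have [cz _] := between_fin w0 c uzv; rewrite conn_sym in cz.
have [b nub] := next_ex w0 cz zu.
have [e eF /norP[ea eb]] : exists2 e, e \in nbr F z & ~~ ((e == a) || (e == b)).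
  case: (boolP (nbr F z \subset [set a; b])) => [|/subsetPn[e eF]].
    move=> /subset_leq_card/(leq_trans deg).
    by rewrite cards2; case: (a != b).
  by rewrite !inE; exists e.
move: eF; rewrite inE => /(Fnext _ _ zQ)[u' [v' [u'Q v'Q c' u'zv' nv'e]]].
apply/bigcupP; exists (u, v, u', v'); first by rewrite !inE uQ vQ u'Q v'Q.
rewrite /br /= c c' inE /branching uzv u'zv' /=; apply/existsP; exists e.
have [_ czv] := between_fin w0 c uzv.
rewrite nv'e /=; apply/andP; split; apply/negP => n.
  by move: eb; rewrite (next_uniq w0 w_inj cz n nub) eqxx.
by move: ea; rewrite (next_uniq w0 w_inj czv n nva) eqxx.
Qed.

(** * Minors *)

Section Minors.
Variable V : finType.
Implicit Types (G H K : graph V) (S F : {set V}).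

Lemma terminal_minor_trans S G H K :
  terminal_minor S G H -> terminal_minor S H K -> terminal_minor S G K.
Proof.
move=> GH; elim=> // {}K.
- by move=> e _ IH; apply: TMinorDelEdge.
- by move=> v _ IH; apply: TMinorDelVertex.
- by move=> u v _ IH; apply: TMinorContract.
Qed.

Lemma sub_terminal_minor S S' G H :
  S \subset S' -> terminal_minor S' G H -> terminal_minor S G H.
Proof.
move=> SS'; have notin v : v \notin S' -> v \notin S by apply/contra/subsetP.
elim=> [|K e _|K v _|K u v _]; first exact: TMinorRefl.
- exact: TMinorDelEdge.
- by move=> IH /setDP[vK /notin vS]; apply: TMinorDelVertex; rewrite // inE vS.
- by move=> IH uv /notin; apply: TMinorContract.
Qed.

Lemma edge_set2 G e : e \in edges G ->
  exists x y, [/\ e = [set x; y], x != y, x \in verts G & y \in verts G].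
Proof.
move=> eG; have /andP[/subsetP eV /cards2P[x [y [xy E]]]] := forall_inP (edges_wf G) _ eG.
by exists x, y; split; rewrite ?eV // E ?set21 ?set22.
Qed.

Lemma adj_neq G x y : adj G x y -> x != y.
Proof.
move=> xy; have /andP[_] := forall_inP (edges_wf G) _ xy.
by rewrite cards2; case: (x != y).
Qed.

Lemma subgraph_minor S G (E : {set {set V}}) : E \subset edges G ->
  exists2 H, terminal_minor S G H & verts H = verts G /\ edges H = E.
Proof.
move=> EG; have [n] := ubnP #|edges G :\: E|; elim: n G EG => // n IH G EG lt.
have [D|/set0Pn[e /setDP[eG eE]]] := eqVneq (edges G :\: E) set0.
  exists G; first exact: TMinorRefl.
  by split=> //; apply/eqP; rewrite eqEsubset EG andbT -setD_eq0 D.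
have [||H GH [vH eH]] := IH (del_edge G e).
- by rewrite subsetD1 EG.
- rewrite -ltnS; apply: leq_trans lt; rewrite ltnS; apply: proper_card.
  rewrite properE setSD ?subsetDl //=; apply/subsetPn; exists e; rewrite !inE ?eE //=.
  by rewrite eqxx.
exists H => //; apply: terminal_minor_trans GH.
by apply: TMinorDelEdge eG; apply: TMinorRefl.
Qed.

Lemma edges_contractP G u v x y :
  reflect (exists a b, [/\ adj G a b, [set a; b] != [set u; v],
                           merge u v a = x & merge u v b = y])
          (adj (contract G u v) x y).
Proof.
apply: (iffP imsetP) => [[e /setD1P[euv eG]]|[a [b [ab uv <- <-]]]]; last first.
  exists [set a; b]; first by rewrite !inE uv.
  by rewrite imsetU1 imset_set1.
have [a [b [E _ _ _]]] := edge_set2 eG.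
rewrite E imsetU1 imset_set1 => /eq_set2[] [-> ->]; [exists a, b|exists b, a].
  by rewrite /adj -E.
by rewrite /adj setUC -E.
Qed.

(** The case u = w is a vertex [v] of degree one, whose contraction creates no edge. *)
Lemma contract_adj G u v w x y : adj G u v -> nbr (edges G) v = [set u; w] ->
  adj (contract G u v) x y = [&& x != v, y != v &
    adj G x y || ([set x; y] == [set u; w]) && (u != w)].
Proof.
move=> uv N; have uNv := adj_neq uv.
have Nv z : adj G v z = (z == u) || (z == w).
  by have := congr1 (fun A : {set V} => z \in A) N; rewrite !inE.
have vw : adj G v w by rewrite Nv eqxx orbT.
have wNv : w != v by rewrite eq_sym (adj_neq vw).
have merge_neq z : z != v -> merge u v z = z by rewrite /merge => /negbTE ->.
have merge_v z : merge u v z != v by rewrite /merge; case: ifPn.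
have mergev : merge u v v = u by rewrite /merge eqxx.
apply/edges_contractP/and3P => [[a [b [ab uvab <- <-]]]|[xv yv]].
  split=> //; have [av|av] := eqVneq a v; last have [bv|bv] := eqVneq b v.
  - move: ab uvab; rewrite av mergev Nv => /orP[]/eqP->.
      by rewrite setUC eqxx.
    move=> h; rewrite (merge_neq w) // eqxx /= orbC.
    by case: (eqVneq u w) h => // ->; rewrite setUC eqxx.
  - move: ab uvab; rewrite bv mergev adj_sym Nv => /orP[]/eqP->.
      by rewrite eqxx.
    move=> h; rewrite (merge_neq w) // setUC eqxx /= orbC.
    by case: (eqVneq u w) h => // ->; rewrite eqxx.
  - by rewrite !merge_neq // ab.
case/orP=> [xy|/andP[/eqP xy uw]].
  exists x, y; rewrite !merge_neq // xy; split=> //.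
  apply/eqP => e; have : v \in [set x; y] by rewrite e set22.
  by rewrite !inE => /orP[] /eqP vE; rewrite vE eqxx in xv yv.
have neq : [set v; w] != [set u; v].
  apply/eqP => e; have : w \in [set u; v] by rewrite -e set22.
  by rewrite !inE (negbTE wNv) orbF eq_sym (negbTE uw).
case/eq_set2: xy => -[-> ->]; [exists v, w|exists w, v].
  by rewrite mergev merge_neq.
by rewrite mergev merge_neq // adj_sym (setUC [set w]).
Qed.

Lemma contract_verts G u v : adj G u v -> verts (contract G u v) = verts G :\ v.
Proof.
move=> uv; have /andP[uG vG] := adj_verts uv; have uNv := adj_neq uv.
apply/setP => x; rewrite !inE; apply/imsetP/andP => [[y yG ->]|[xv xG]].
  by rewrite /merge; case: (eqVneq y v) => [_|yv]; split.
by exists x => //; rewrite /merge (negbTE xv).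
Qed.

(** An isolated vertex is deleted, any other is contracted into a neighbour. The degree bound
    ensures that repeated suppression creates no new vertices of degree at least 3. *)
Lemma suppress (R : realType) S G (l : {set V} -> R) v :
  nonneg_lengths G l -> v \in verts G :\: S -> (#|nbr (edges G) v| <= 2)%N ->
  exists G' l', [/\ terminal_minor S G G', nonneg_lengths G' l',
    verts G' = verts G :\ v,
    forall z, z != v -> (#|nbr (edges G') z| <= #|nbr (edges G) z|)%N &
    forall x y r, x != v -> y != v ->
      walk (edges G) l y x r <-> walk (edges G') l' y x r].
Proof.
move=> l0 vGS; have /setDP[vG vS] := vGS.
have [N0 _|/set0Pn[u uN] N2] := eqVneq (nbr (edges G) v) set0.
  exists (del_vertex G v), l.
  have E : edges (del_vertex G v) = edges G.
    apply/setP => e; rewrite inE; case: (boolP (e \in edges G)) => //= eG.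
    have [x [y [E _ _ _]]] := edge_set2 eG; apply: contraT; rewrite negbK E => ve.
    suff : exists z, z \in nbr (edges G) v by case=> z; rewrite N0 inE.
    move: ve eG; rewrite E !inE => /orP[]/eqP->; [exists y|exists x].
      by rewrite inE.
    by rewrite inE setUC.
  split=> //; first exact: TMinorDelVertex (TMinorRefl _ _) vGS.
    by move=> e; rewrite E; apply: l0.
  by move=> z _; rewrite E.
  by move=> x y r _ _; rewrite E.
have [w N] : exists w, nbr (edges G) v = [set u; w].
  have [D|/set0Pn[w /setD1P[wu wN]]] := eqVneq (nbr (edges G) v :\ u) set0.
    by exists u; rewrite setUid -(setD1K uN) D setU0.
  exists w; apply/esym/eqP; rewrite eqEcard cards2 eq_sym wu N2 andbT.
  by apply/subsetP => z; rewrite !inE => /orP[]/eqP->; [move: uN|move: wN]; rewrite inE.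
have uv : adj G u v by move: uN; rewrite inE setUC.
have vw : adj G v w.
  by have := set22 u w; rewrite -N inE.
have uNv := adj_neq uv.
have wNv : w != v by rewrite eq_sym (adj_neq vw).
have luv := l0 _ uv; have lvw := l0 _ vw.
set G' := contract G u v.
pose s := l [set u; v] + l [set v; w].
(* The new edge may be parallel to an old one; the survivor gets the smaller of the two lengths. *)
pose l' e := if e == [set u; w] then
  (if e \in edges G then Num.min (l e) s else s) else l e.
have adjG' := contract_adj _ _ uv N; rewrite -/G' in adjG'.
have l'_le x y : adj G x y -> l' [set x; y] <= l [set x; y].
  by move=> xy; rewrite /l'; case: ifP => // _; rewrite [_ \in _]xy ge_min lexx.
have l'uw : l' [set u; w] <= s.
  by rewrite /l' eqxx; case: ifP => // _; rewrite ge_min lexx orbT.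
have uw_walk x y : [set x; y] = [set u; w] -> walk (edges G) l y x s.
  have W : walk (edges G) l w u s by apply: walk_cat (walk1 l uv) (walk1 l vw).
  by case/eq_set2 => -[-> ->] //; apply: walk_sym.
exists G', l'; split.
- exact: TMinorContract (TMinorRefl _ _) uv vS.
- move=> e eG'; have [x [y [E _ _ _]]] := edge_set2 eG'.
  move: eG'; rewrite E -[_ \in _]/(adj G' x y) adjG' /l' => /and3P[_ _].
  case: ifP => [/eqP xyuw _|_]; last by rewrite andFb orbF => /l0.
  by case: ifP => [/l0 xy|_]; rewrite ?le_min ?xy addr_ge0.
- exact: contract_verts.
- have nbrG' z a : a \in nbr (edges G') z -> a != v /\
      (a \in nbr (edges G) z \/ [set z; a] = [set u; w]).
    rewrite [a \in _]inE -[_ \in edges G']/(adj G' z a) adjG' => /and3P[_ av].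
    by case/orP => [za|/andP[/eqP za _]]; split=> //; [left; rewrite inE|right].
  have end_case z z' : [set z; z'] = [set u; w] -> adj G z v ->
      (#|nbr (edges G') z| <= #|nbr (edges G) z|)%N.
    move=> zz' zv; rewrite (cardsD1 v (nbr (edges G) z)) inE [_ \in edges G]zv.
    apply: leq_trans (_ : #|z' |: (nbr (edges G) z :\ v)| <= _)%N.
      apply: subset_leq_card; apply/subsetP => a /nbrG'[av [az|za]].
        by rewrite in_setU1 in_setD1 av az orbT.
      by move: za; rewrite -zz' => /eq_set2[[_ ->]|[-> ->]]; rewrite setU11.
    by rewrite cardsU1 leq_add2r; case: (_ \notin _).
  move=> z zv; have [->|zu] := eqVneq z u; first exact: end_case uv.
  have [->|zw] := eqVneq z w; first by apply: (end_case w u); rewrite 1?setUC 1?adj_sym.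
  apply: subset_leq_card; apply/subsetP => a /nbrG'[_ [//|za]].
  have : z \in [set u; w] by rewrite -za set21.
  by rewrite !inE (negbTE zu) (negbTE zw).
move=> x y r xv yv; split; last first.
  elim=> [t t0|a b t t' ab _ IH le]; first exact: walk_nil.
  suff W : walk (edges G) l b a (l' [set a; b]) by apply: walk_le (walk_cat W IH).
  move: ab; rewrite -[_ \in _]/(adj G' a b) adjG' /l' => /and3P[_ _].
  case: ifP => [/eqP E _|_]; last by rewrite andFb orbF; apply: walk1.
  case: ifP => [ab|_]; last exact: uw_walk.
  by rewrite /Num.min; case: ifP => _; [apply: walk1|apply: uw_walk].
have G'uw a b : [set a; b] = [set u; w] -> a != b -> [set a; b] \in edges G'.
  move=> ab anb; rewrite -[_ \in _]/(adj G' a b) adjG'.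
  have ends z : z \in [set u; w] -> z != v by rewrite !inE => /orP[]/eqP->.
  rewrite !ends -?ab ?set21 ?set22 // eqxx /=.
  case: (eqVneq u w) => [uw|]; rewrite ?orbT //.
  have : a \in [set u; w] by rewrite -ab set21.
  have : b \in [set u; w] by rewrite -ab set22.
  by rewrite !inE uw !orbb => /eqP ba /eqP aa; rewrite aa ba eqxx in anb.
(* A walk can start at [v] after its first step, so the induction also treats such walks: they
   become walks from either neighbour of [v], with the length of the edge back to [v] added. *)
move=> W; suff : (x != v -> walk (edges G') l' y x r) /\ (x = v ->
    walk (edges G') l' y u (r + l [set u; v]) /\
    walk (edges G') l' y w (r + l [set v; w])) by case=> /(_ xv).
elim: W {xv} => [t t0|a b t t' ab _ [IH1 IH2] le].
  by split=> [_|yE]; [apply: walk_nil|rewrite yE eqxx in yv].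
have Nv z : adj G v z -> z = u \/ z = w.
  move=> vz; have : z \in nbr (edges G) v by rewrite inE.
  by rewrite N !inE => /orP[]/eqP; [left|right].
split=> [av|av].
  have [bv|bv] := eqVneq b v.
    have [IHu IHw] := IH2 bv; rewrite {}bv in ab le *.
    have [E|E] := Nv _ (etrans (adj_sym _ _ _) ab); rewrite E in le *.
      by apply: walk_le IHu; rewrite addrC.
    by apply: walk_le IHw; rewrite addrC setUC.
  apply: (walk_cons _ (IH1 bv)); last by have := l'_le _ _ ab; lra.
  by rewrite -[_ \in _]/(adj G' a b) adjG' av bv [adj G a b]ab.
rewrite {}av in ab le *; have bv : b != v by rewrite eq_sym (adj_neq ab).
have {}IH1 := IH1 bv.
have hop z z' : [set z; z'] = [set u; w] -> forall t1, walk (edges G') l' y z t' ->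
    t' + s <= t1 -> walk (edges G') l' y z' t1.
  move=> zz' t1 Wz le1; have [<-|zNz'] := eqVneq z z'.
    by apply: walk_le Wz; rewrite /s in le1; lra.
  have z'z : [set z'; z] = [set u; w] by rewrite setUC.
  by apply: (walk_cons (G'uw z' z z'z _) Wz); rewrite 1?eq_sym // z'z; lra.
have [E|E] := Nv _ ab; rewrite E in IH1 le *.
  split; first by apply: walk_le IH1; move: le; rewrite (setUC [set v]); lra.
  by apply: (hop u w erefl _ IH1); move: le; rewrite /s (setUC [set v] [set u]); lra.
split; last by apply: walk_le IH1; lra.
by apply: (hop w u (setUC _ _) _ IH1); move: le; rewrite /s; lra.
Qed.

(** Suppress as long as possible. Degrees never grow, so a surviving nonterminal had degree at least
    3 from the start. *)
Lemma reduce_minor (R : realType) S G (l : {set V} -> R) : nonneg_lengths G l ->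
  exists G' l', [/\ terminal_minor S G G', nonneg_lengths G' l',
    {in S &, forall x y r, walk (edges G) l y x r <-> walk (edges G') l' y x r} &
    (#|verts G'| <= #|S| + #|[set z | z \notin S & 2 < #|nbr (edges G) z|]|)%N].
Proof.
have [n] := ubnP #|verts G|; elim: n G l => // n IH G l ltn l0.
case: (pickP [pred v in verts G :\: S | (#|nbr (edges G) v| <= 2)%N]) => [v|no].
  move=> /andP[/= vGS v2]; have [G1 [l1 [GG1 l10 vG1 deg1 w1]]] := suppress l0 vGS v2.
  have /setDP[vG vS] := vGS.
  have [||G' [l' [G1G' l'0 w' card']]] := IH G1 l1 => //.
    by rewrite vG1; rewrite (cardsD1 v) vG in ltn.
  exists G', l'; split=> //; first exact: terminal_minor_trans G1G'.
    move=> x y xS yS r; apply: iff_trans (w' _ _ xS yS r); apply: w1;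
    by [apply: contraNneq vS => <-].
  apply: leq_trans card' _; rewrite leq_add2l.
  apply: subset_leq_card; apply/subsetP => z; rewrite !inE => /andP[-> d].
  have [zv|zv] := eqVneq z v; last exact: leq_trans (deg1 _ zv).
  suff N0 : nbr (edges G1) z = set0 by rewrite N0 cards0 in d.
  apply/setP => a; rewrite !inE zv; apply/negP => /adj_verts/andP[].
  by rewrite vG1 setD11.
exists G, l; split=> //; first exact: TMinorRefl.
apply: leq_trans (leq_card_setU _ _); apply: subset_leq_card; apply/subsetP => v vG.
rewrite !inE; case: (boolP (v \in S)) => //= vS.
by have := no v; rewrite /= inE vS vG /= => /negbT; rewrite -ltnNge.
Qed.

End Minors.

(** * The upper bound *)

Lemma bigcup_seqP (I : eqType) (T : finType) (r : seq I) (F : I -> {set T}) x :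
  reflect (exists2 i, i \in r & x \in F i) (x \in \bigcup_(i <- r) F i).
Proof.
elim: r => [|i r IH]; first by rewrite big_nil inE; constructor; case.
rewrite big_cons inE; apply: (iffP orP) => [[xi|/IH[j jr xj]]|[j]].
- by exists i; rewrite ?mem_head.
- by exists j; rewrite // inE jr orbT.
- by rewrite inE => /predU1P[->|jr xj]; [left|right; apply/IH; exists j].
Qed.

Lemma bigcup_seq_sup (I : eqType) (T : finType) (r : seq I) (F : I -> {set T}) i :
  i \in r -> F i \subset \bigcup_(j <- r) F j.
Proof.
by move=> ir; apply/subsetP => x xi; apply/bigcup_seqP; exists i.
Qed.

(** [n] is the number of regions; each contributes at most 5q terminals and the branch vertices of
    its sparse subgraph. *)
Lemma treewidth_minor (R : realType) (V I : finType) (G : graph V) (T : graph I)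
    (B : I -> {set V}) (q : nat) (S : {set V}) (l : {set V} -> R) :
  tree_decomposition G T B -> (forall i, i \in verts T -> #|B i| <= q)%N ->
  (0 < q)%N -> S \subset verts G -> nonneg_lengths G l ->
  exists G' l' n, [/\ distance_preserving_minor G l S G' l',
    (n * q <= #|S| + q)%N & (#|verts G'| <= n * (5 * q + 2 * (5 * q) ^ 4))%N].
Proof.
move=> TB Bq q0 SG l0.
have [rs [szrs edgrs covrs proprs caprs]] :=
  region_decomposition TB Bq q0 (subxx (verts G)) SG.
pose E (r : {set V} * {set V}) := [set e in edges G | e \subset r.1].
have EG r : E r \subset edges G by apply/subsetP => e; rewrite inE => /andP[].
have /boolp.choice[F FP] r := @sparse_preserver R V (E r) r.2 l
  (fun e eE => l0 e (subsetP (EG r) e eE)).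
(* The terminals of all regions are kept, so that the minor may be reduced without disconnecting the
   pieces of a path from each other. *)
pose S' := \bigcup_(r <- rs) r.2.
pose H := \bigcup_(r <- rs) F r.
have FH r : r \in rs -> F r \subset H by apply: bigcup_seq_sup.
have HG : H \subset edges G.
  apply/subsetP => e /bigcup_seqP[r _]; have [FE _ _] := FP r.
  by move=> /(subsetP FE)/(subsetP (EG r)).
have SS' : S \subset S'.
  apply/subsetP => x xS; have /bigcup_seqP[r rrs xr] := subsetP covrs _ (subsetP SG _ xS).
  have [_ _ _ /subsetP Xr] := proprs _ rrs.
  by apply/bigcup_seqP; exists r; rewrite // Xr // inE xS.
have inS' x r : r \in rs -> x \in r.1 -> x \in S' -> x \in r.2.
  move=> rrs xr /bigcup_seqP[s srs xs]; have [->//|rs_] := eqVneq r s.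
  have [_ /subsetP s21 _ _] := proprs _ srs.
  have /subsetP/(_ x) := caprs _ _ rrs srs rs_.
  by rewrite !inE xr s21 //= => /(_ isT) /andP[].
have inF r x y t : r \in rs -> x \in r.2 -> y \in r.2 ->
    walk (E r) l y x t -> walk H l y x t.
  move=> rrs xr yr W; have [_ FW _] := FP r.
  exact: walk_sub (FH _ rrs) (FW _ _ xr yr _ W).
(* Follow the walk inside the region [r] up to a terminal [z] of [r]; the rest is already replaced
   by a walk in [H]. Where an edge belongs to another region [s], its first vertex is a terminal of
   both, so the stretch inside [s] joins two terminals of [s] and can be replaced too. *)
have leave y x t : walk (edges G) l y x t -> y \in S' ->
    forall r, r \in rs -> x \in r.1 -> exists z t1 t2, [/\ z \in r.2,
      walk (E r) l z x t1, walk H l y z t2 & t1 + t2 <= t].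
  move=> W yS'; elim: W => [t' t'0|a b t1 t2 ab _ IH le] r rrs xr.
    exists y, 0, 0; split; [exact: inS'|exact: walk_nil|exact: walk_nil|lra].
  have abG : [set a; b] \subset verts G.
    by have /andP[] := forall_inP (edges_wf G) _ ab.
  have [s srs abs] := edgrs _ ab abG.
  have as1 : a \in s.1 by rewrite (subsetP abs) ?set21.
  have bs1 : b \in s.1 by rewrite (subsetP abs) ?set22.
  have [z [u1 [u2 [zs W1 W2 le']]]] := IH s srs bs1.
  have Wa : walk (E s) l z a (l [set a; b] + u1).
    by apply: walk_cons W1 (lexx _); rewrite inE ab.
  have [rs_|rs_] := eqVneq r s.
    by exists z, (l [set a; b] + u1), u2; rewrite rs_; split=> //; lra.
  have : a \in r.2 :&: s.2 by apply: (subsetP (caprs _ _ rrs srs rs_)); rewrite inE xr.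
  rewrite inE => /andP[ar as2].
  exists a, 0, (l [set a; b] + u1 + u2); split=> //; first exact: walk_nil.
    exact: walk_cat (inF _ _ _ _ srs as2 zs Wa) W2.
  by lra.
have preserve x y t : x \in S' -> y \in S' ->
    walk (edges G) l y x t <-> walk H l y x t.
  move=> xS' yS'; split; last exact: walk_sub.
  have /bigcup_seqP[r rrs xr] := xS'.
  have [_ /subsetP r21 _ _] := proprs _ rrs.
  move=> /leave/(_ yS' r rrs (r21 _ xr))[z [t1 [t2 [zr W1 W2 le]]]].
  exact: walk_le le (walk_cat (inF _ _ _ _ rrs xr zr W1) W2).
have [H' GH' [_ eH']] := subgraph_minor S' HG.
have l0' : nonneg_lengths H' l by move=> e; rewrite eH' => /(subsetP HG)/l0.
have [G' [l' [HG' l'0 W' card']]] := reduce_minor S' l0'.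
exists G', l', (size rs); split=> //.
  split=> //.
    exact: sub_terminal_minor SS' (terminal_minor_trans GH' HG').
  move=> x y xS yS; have xS' := subsetP SS' _ xS; have yS' := subsetP SS' _ yS.
  apply/esym/eq_dist => // t; apply: iff_trans (W' _ _ xS' yS' t).
  by rewrite eH'; apply: preserve.
apply: leq_trans card' _; rewrite mulnDr eH'.
have sum_rs c : (\sum_(r <- rs) c = size rs * c)%N.
  by rewrite big_const_seq count_predT iter_addn_0 mulnC.
apply: leq_add.
  apply: leq_trans (leq_card_bigcup _ _ _) _; rewrite -sum_rs.
  by rewrite big_seq [leqRHS]big_seq; apply: leq_sum => r /proprs[].
(* A vertex that is a terminal of no region lies in only one region, so all its edges in [H] come
   from the same [F r]. *)
pose br (r : {set V} * {set V}) := [set z | z \notin r.2 & (2 < #|nbr (F r) z|)%N].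
apply: leq_trans (_ : #|\bigcup_(r <- rs) br r| <= _)%N; last first.
  apply: leq_trans (leq_card_bigcup _ _ _) _; rewrite -sum_rs.
  rewrite big_seq [leqRHS]big_seq; apply: leq_sum => r /proprs[_ _ rq _].
  have [_ _ /leq_trans] := FP r; apply.
  by rewrite leq_mul2l leq_exp2r.
apply: subset_leq_card; apply/subsetP => z; rewrite inE => /andP[zS' deg].
have inside r a : [set z; a] \in F r -> z \in r.1.
  have [FE _ _] := FP r; move=> /(subsetP FE); rewrite inE => /andP[_ /subsetP].
  by apply; rewrite set21.
have [a] : exists a, a \in nbr H z.
  by apply/set0Pn; rewrite -card_gt0; apply: leq_trans deg.
rewrite inE => /bigcup_seqP[r rrs /inside zr].
apply/bigcup_seqP; exists r; rewrite // inE; apply/andP; split.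
  by apply: contra zS' => zr2; apply: (subsetP (bigcup_seq_sup snd rrs)).
apply: leq_trans deg _; apply: subset_leq_card; apply/subsetP => b; rewrite !inE.
case/bigcup_seqP=> s srs zb; have [->//|rs_] := eqVneq r s.
have := subsetP (caprs _ _ rrs srs rs_) z; rewrite !inE zr (inside _ _ zb) => /(_ isT).
case/andP => zr2 _; case/negP: zS'.
exact: (subsetP (bigcup_seq_sup snd rrs)).
Qed.

Lemma TW_decomposition (V : finType) (G : graph V) p : TW p G ->
  exists (I : finType) (T : graph I) (B : I -> {set V}), tree_decomposition G T B /\
    forall i, i \in verts T -> (#|B i| <= p.+1)%N.
Proof.
case=> w [[I [T [B [TB wTB]]]] _] wp; exists I, T, B; split=> // i iT.
have := @leq_bigmax_cond _ (mem (verts T)) (fun i => #|B i|) _ iT.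
by move: wTB wp; rewrite /width; case: (\max_(i in _) _)%N => [|m] /=; lia.
Qed.

(** With q = p + 1 the number of regions times q is at most k + p + 1, hence at most 3k. The
    coefficient 1250 is 2 * 5^4, and 8 comes from p + 1 being at most 2p. *)
Lemma fstar_TW_le (R : realType) p k : (1 <= p)%N -> (p <= k)%N ->
  admits_dp_minors R k (TW p) (3 * k * (8 * 1255 * p ^ 3)).
Proof.
move=> p1 pk V G l S /TW_decomposition[I [T [B [TB Bp]]]] l0 SG Sk.
have [G' [l' [n [dp nq card']]]] := treewidth_minor TB Bp (ltn0Sn p) SG l0.
exists G', l'; split=> //; apply: leq_trans card' _; rewrite {}Sk in nq.
clear -p1 pk nq.
have -> : (n * (5 * p.+1 + 2 * (5 * p.+1) ^ 4) =
    n * p.+1 * (5 + 1250 * p.+1 ^ 3))%N by ring.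
have h1 : (n * p.+1 <= 3 * k)%N by apply: leq_trans nq _; lia.
have h2 : (p.+1 ^ 3 <= 8 * p ^ 3)%N.
  by rewrite -[8%N]/(2 ^ 3)%N -expnMn leq_exp2r //; lia.
have h3 : (1 <= p ^ 3)%N by rewrite expn_gt0 p1.
apply: leq_trans (leq_mul h1 (_ : _ <= 8 * 1255 * p ^ 3)%N) (leqnn _).
by move: h2 h3; generalize (p.+1 ^ 3)%N (p ^ 3)%N; lia.
Qed.

(** * Distance-preserving minors of grids *)

(** The branch sets of the minor, encoded as the fibres of one map [f] on the set [D] of vertices
    that no deletion has removed. Deleting a vertex discards its whole fibre; contracting an edge
    unites two fibres. *)
Lemma minor_model (V : finType) (S : {set V}) (G H : graph V) :
  terminal_minor S G H -> S \subset verts G ->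
  exists (D : {set V}) (f : V -> V),
    [/\ verts H = f @: D, S \subset D, {in S, forall s, f s = s},
        forall x y, adj H x y ->
          exists a b, [/\ a \in D, b \in D, adj G a b, f a = x & f b = y] &
        {in D &, forall a b, f a = f b ->
          connect [rel c e in D | adj G c e && (f c == f e)] a b}].
Proof.
move=> GH SG; elim: GH => [|K e _ IH _|K v _ IH /setDP[_ vS]|K u v _ IH uv vS].
- exists (verts G), id; split=> //; first by rewrite imset_id.
    by move=> x y xy; have /andP[xG yG] := adj_verts xy; exists x, y.
  by move=> a b _ _ ->.
- have [D [f [vK SD fS adjK fib]]] := IH; exists D, f; split=> //.
  by move=> x y; rewrite /adj inE => /andP[_]; apply: adjK.
- have [D [f [vK SD fS adjK fib]]] := IH.
  exists [set a in D | f a != v], f; split=> //.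
  + apply/setP => x; rewrite !inE vK; apply/andP/imsetP.
      by case=> xv /imsetP[a aD E]; exists a; rewrite // inE aD -E.
    case=> a; rewrite inE => /andP[aD av] ->; split=> //.
    exact: imset_f.
  + apply/subsetP => s sS; rewrite inE (subsetP SD) // fS //.
    by apply: contraNneq vS => <-.
  + move=> x y; rewrite /adj !inE negb_or => /andP[xy /andP[vx vy]].
    have [a [b [aD bD ab E1 E2]]] := adjK _ _ xy.
    by exists a, b; rewrite !inE aD bD E1 E2 eq_sym vx eq_sym vy.
  + move=> a b; rewrite !inE => /andP[aD av] /andP[bD bv] ab.
    pose e := [rel c e in [set a in D | f a != v] | adj G c e && (f c == f e)].
    suff : (f b == f a) && connect e a b by case/andP.
    apply: (connect_invariant (P := fun z => (f z == f a) && connect e a z))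
      (fib _ _ aD bD ab) _.
      move=> c d /= /andP[/andP[cD dD] /andP[cd /eqP fcd]] /andP[/eqP ca ac].
      rewrite -fcd ca eqxx; apply: connect_trans ac (connect1 _).
      by rewrite /= !inE cD dD cd -fcd ca av eqxx.
    by rewrite eqxx connect0.
- have [D [f [vK SD fS adjK fib]]] := IH.
  exists D, (merge u v \o f); split=> //.
  + by rewrite /= vK imset_comp.
  + move=> s sS; rewrite /= fS // /merge; case: eqP => // sv.
    by rewrite -sv sS in vS.
  + move=> x y /edges_contractP[x' [y' [xy _ <- <-]]].
    have [a [b [aD bD ab <- <-]]] := adjK _ _ xy.
    by exists a, b.
  + pose e := [rel c e in D | adj G c e &&
      (merge u v (f c) == merge u v (f e))].
    have fib' c d : c \in D -> d \in D -> f c = f d -> connect e c d.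
      move=> cD dD cd; apply: connect_sub (fib _ _ cD dD cd) => x y.
      move=> /= /andP[xyD /andP[xy /eqP fxy]]; apply: connect1.
      by rewrite /= xyD xy fxy eqxx.
    (* This edge of the original graph joins the two fibres being united. *)
    have [c [d [cD dD cd fc fd]]] := adjK _ _ uv.
    have ecd : connect e c d.
      by apply: connect1; rewrite /= cD dD cd fc fd /merge if_same !eqxx.
    have e_sym : connect_sym e.
      apply: sym_connect_sym => x y /=.
      by rewrite adj_sym eq_sym (andbC (x \in D)).
    move=> a b aD bD; rewrite /= /merge.
    have [av|av] := eqVneq (f a) v; have [bv|bv] := eqVneq (f b) v => E.
    * by apply: fib' => //; rewrite av bv.
    * apply: connect_trans (fib' a d aD dD _) _; first by rewrite av fd.
      by rewrite e_sym; apply: connect_trans (fib' b c bD cD _) ecd; rewrite -E fc.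
    * apply: connect_trans (fib' a c aD cD _) _; first by rewrite E fc.
      by apply: connect_trans ecd (fib' d b dD bD _); rewrite bv fd.
    * exact: fib'.
Qed.

Lemma path_vertex_walk (R : realType) (V : finType) (F : {set {set V}})
    (l : {set V} -> R) x p z : path (within F) x p -> z \in x :: p ->
  exists t1 t2, [/\ walk F l z x t1, walk F l (last x p) z t2
                  & t1 + t2 = path_length l x p].
Proof.
move=> pP zp; case/splitPl: zp pP => p1 p2 pz; rewrite cat_path => /andP[pP1 pP2].
exists (path_length l x p1), (path_length l z p2); split.
- by rewrite -pz; apply: path_walk.
- by rewrite last_cat pz; apply: path_walk; rewrite -pz.
- by rewrite /path_length pairmap_cat big_cat /= pz.
Qed.

(** * Rigidity of grids *)

Section Grid.
Variables (V : finType) (G : graph V).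
Implicit Types (rho kap : V -> nat) (r N : nat).

(** Coordinates are functions on an arbitrary vertex type, so that exchanging them transposes the
    grid while the graph, its minor and the lengths stay the same. *)
Definition grid_coords rho kap r N :=
  [/\ forall x, (rho x < r)%N /\ (kap x < N)%N,
      forall x y, rho x = rho y -> kap x = kap y -> x = y,
      forall i j, (i < r)%N -> (j < N)%N -> exists x, rho x = i /\ kap x = j &
      forall x y, adj G x y <->
        (rho x = rho y /\ (kap x = (kap y).+1 \/ kap y = (kap x).+1)) \/
        (kap x = kap y /\ (rho x = (rho y).+1 \/ rho y = (rho x).+1))].

Lemma grid_coordsC rho kap r N : grid_coords rho kap r N -> grid_coords kap rho N r.
Proof.
case=> bd inj ex adjE; split.
- by move=> x; have [] := bd x.
- by move=> x y h1 h2; apply: inj.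
- by move=> i j hi hj; have [x []] := ex j i hj hi; exists x.
- by move=> x y; rewrite adjE; tauto.
Qed.

Lemma card_column rho kap r N j : grid_coords rho kap r N ->
  (#|[set x | kap x == j]| <= r)%N.
Proof.
case=> bd inj _ _; pose h x := Ordinal (proj1 (bd x)).
rewrite -[leqRHS]card_ord -(card_in_imset (f := h)); first exact: max_card.
move=> x y; rewrite !inE => /eqP xj /eqP yj /(congr1 val) /= E.
by apply: inj => //; rewrite xj yj.
Qed.

(* Each U i meets every column, and a column has only r vertices, so each U i
   has exactly one vertex in each column and cannot leave its row. *)
Lemma disjoint_crossings rho kap r N (U : 'I_r -> {set V}) :
  grid_coords rho kap r N ->
  (forall i, {in U i &, forall x y, connect [rel a b in U i | adj G a b] x y}) ->
  (forall i i' x, x \in U i -> x \in U i' -> i = i') ->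
  (forall i, exists x, [/\ x \in U i, rho x = i & kap x = 0%N]) ->
  (forall i, exists2 x, x \in U i & kap x = N.-1) ->
  forall x (i : 'I_r), rho x = i -> x \in U i.
Proof.
move=> coords conU disU leftU rightU; have [bd inj ex adjE] := coords.
(* An edge changes [kap] by at most one, so a connected set cannot skip a column. *)
have meet i j : (j < N)%N -> exists2 x, x \in U i & kap x = j.
  move=> jN; have [x0 [x0U _ k0]] := leftU i; have [x1 x1U k1] := rightU i.
  have [j0|j0] := posnP j; first by exists x0; rewrite // j0.
  suff /exists_inP[x xU /eqP xj] : [exists x in U i, kap x == j] by exists x.
  apply: contraT; rewrite negb_exists_in => /forall_inP no.
  have : (kap x1 < j)%N; last by rewrite k1; lia.
  apply: (connect_invariant (P := fun z => (kap z < j)%N)) (conU i _ _ x0U x1U) _.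
    move=> a b /= /andP[/andP[_ bU] /adjE ab] aj; move: (no _ bU); lia.
  by rewrite k0.
have uniqU i x y : x \in U i -> y \in U i -> kap x = kap y -> x = y.
  move=> xU yU xy; have jN := proj2 (bd x).
  have /fin_all_exists2[g gU gj] i' := meet i' _ jN.
  have g_inj : injective g.
    by move=> i1 i2 E; apply: disU (gU i1) _; rewrite E.
  have imE : g @: setT = [set z | kap z == kap x].
    apply/eqP; rewrite eqEcard card_imset // cardsT card_ord (card_column _ coords) andbT.
    by apply/subsetP => z /imsetP[i' _ ->]; rewrite inE gj.
  have toward z : z \in U i -> kap z = kap x -> z = g i.
    move=> zU /eqP zx; have : z \in g @: setT by rewrite imE inE.
    by case/imsetP => i' _ zE; rewrite (disU i i' z) // zE.
  by rewrite (toward _ xU erefl) (toward _ yU (esym xy)).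
have rowU i x : x \in U i -> rho x = i.
  move=> xU; have [x0 [x0U r0 _]] := leftU i; apply/eqP.
  apply: (connect_invariant (P := fun z => rho z == i)) (conU i _ _ x0U xU) _;
    last by rewrite r0.
  move=> a b /= /andP[/andP[aU bU] /adjE[[-> //]|[kab _]]].
  by rewrite (uniqU i a b).
move=> x i xi; have [y yU yx] := meet i _ (proj2 (bd x)).
by rewrite (inj x y) // xi (rowU _ _ yU).
Qed.

Variable R : realType.
Let unit_length (e : {set V}) : R := 1.

(** The truncated differences in both orders add up to an absolute value, so the bound is the
    Manhattan distance. *)
Lemma grid_walk_ge rho kap r N x y t : grid_coords rho kap r N ->
  walk (edges G) unit_length y x t ->
  ((rho x - rho y) + (rho y - rho x) + (kap x - kap y) + (kap y - kap x))%:R <= t.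
Proof.
case=> _ _ _ adjE; elim=> [t' t0|a b t1 t2 /adjE ab _ IH le]; first by rewrite !subnn.
apply: le_trans le; rewrite /unit_length.
have h : ((rho a - rho y) + (rho y - rho a) + (kap a - kap y) + (kap y - kap a) <=
  1 + ((rho b - rho y) + (rho y - rho b) + (kap b - kap y) + (kap y - kap b)))%N.
  by clear -ab; lia.
by apply: le_trans (_ : _ <= (1 + _)%N%:R) _;
  [rewrite ler_nat; exact: h|rewrite natrD lerD2l].
Qed.

Lemma grid_row_walk rho kap r N x y : grid_coords rho kap r N ->
  rho x = rho y -> kap x = 0%N -> walk (edges G) unit_length y x (kap y)%:R.
Proof.
case=> bd inj ex adjE; move: {-1}(kap y) (erefl (kap y)) => j.
elim: j y => [|j IH] y yj xy x0.
  by rewrite (inj x y) ?x0 //; apply: walk_nil.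
have jN : (j < N)%N by have [_] := bd y; rewrite yj; apply: ltnW.
have [z [zx zj]] := ex (rho x) j (proj1 (bd x)) jN.
have zy : adj G z y by apply/adjE; left; rewrite zx zj yj; split=> //; right.
rewrite -natr1; apply: walk_cat (IH z _ _ x0) (walk1 _ zy); by rewrite ?zx.
Qed.

(** The model [D], [f] is given from outside and the boundary condition concerns the first and last
    columns alone. With the coordinates exchanged the same model therefore yields the statement for
    columns. *)
Lemma rows_survive rho kap r N (S : {set V}) (G' : graph V) l'
    (D : {set V}) (f : V -> V) :
  grid_coords rho kap r N ->
  distance_preserving_minor G unit_length S G' l' ->
  S \subset D -> {in S, forall s, f s = s} ->
  (forall x y, adj G' x y ->
    exists a b, [/\ a \in D, b \in D, adj G a b, f a = x & f b = y]) ->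
  {in D &, forall a b, f a = f b ->
    connect [rel c e in D | adj G c e && (f c == f e)] a b} ->
  (forall x, kap x = 0%N \/ kap x = N.-1 -> x \in S) ->
  forall x, x \in D /\ forall y, f x = f y -> rho x = rho y.
Proof.
move=> coords [_ l'0 dG'] SD fS adjG' fib bdS x.
have [bd inj ex adjE] := coords; have [xr xN] := bd x.
have N0 : (0 < N)%N by apply: leq_ltn_trans xN.
have l0 : nonneg_lengths G unit_length by move=> e _; apply: ler01.
have /fin_all_exists[L LP] (i : 'I_r) := ex i 0%N (ltn_ord i) N0.
have /fin_all_exists[M MP] (i : 'I_r) : exists x, rho x = i /\ kap x = N.-1.
  by apply: ex; rewrite ?ltn_predL.
have LS i : L i \in S by apply: bdS; left; have [] := LP i.
have MS i : M i \in S by apply: bdS; right; have [] := MP i.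
(* An infimum only gives paths above the distance, whence the slack 1/2. Two such paths have total
   length at most 2N - 1, whereas exchanging their ends at a common vertex would give two walks of
   length at least N each. *)
have pathP i : exists p, [/\ path (adj G') (L i) p, last (L i) p = M i &
    path_length l' (L i) p <= N.-1%:R + 2^-1].
  have [rL kL] := LP i; have [rM kM] := MP i.
  have := grid_row_walk coords (etrans rL (esym rM)) kL; rewrite kM.
  move=> /(dist_le l0); rewrite -dG' // => le.
  have /dist_lt/(walk_path l'0)[p [pP _ pl len]] :
    (dist G' l' (L i) (M i) < (N.-1%:R + 2^-1)%:E)%E.
    by apply: le_lt_trans le _; rewrite lte_fin ltrDl invr_gt0.
  by exists p.
have /fin_all_exists[p pP] := pathP.
have far i i' t : i != i' -> walk (edges G') l' (M i') (L i) t -> N%:R <= t.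
  move=> ii' /(dist_le l'0); rewrite dG' // => le; rewrite -lee_fin.
  apply: le_trans le; apply: dist_ge => s /(grid_walk_ge coords).
  have [-> ->] := LP i; have [-> ->] := MP i'; apply: le_trans.
  by rewrite ler_nat; move: ii' N0; rewrite -val_eqE /=; clear; lia.
pose U i := [set a in D | f a \in L i :: p i].
have disP i i' z : z \in L i :: p i -> z \in L i' :: p i' -> i = i'.
  have [pPi pli leni] := pP i; have [pPi' pli' leni'] := pP i'.
  move=> /(path_vertex_walk l' pPi)[t1 [t2 [W1 W2 E]]].
  move=> /(path_vertex_walk l' pPi')[s1 [s2 [W1' W2' E']]].
  apply/eqP; apply/negPn/negP => ii'; rewrite pli in W2; rewrite pli' in W2'.
  have := far _ _ _ ii' (walk_cat W1 W2').
  rewrite eq_sym in ii'; have := far _ _ _ ii' (walk_cat W1' W2).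
  have : N%:R = N.-1%:R + 1 :> R by rewrite natr1 prednK.
  by have : 2^-1 + 2^-1 = 1 :> R by [lra]; lra.
have conU i : {in U i &, forall a b, connect [rel c e in U i | adj G c e] a b}.
  set e := [rel c e in U i | adj G c e].
  have e_sym : connect_sym e := sym_connect_sym (@rel_in_sym _ G (U i)).
  have fibU a b : a \in U i -> b \in D -> f a = f b -> connect e a b.
    rewrite inE => /andP[aD aP] bD ab; suff : (f b == f a) && connect e a b by case/andP.
    apply: (connect_invariant (P := fun z => (f z == f a) && connect e a z))
      (fib _ _ aD bD ab) _.
      move=> c d /= /andP[/andP[cD dD] /andP[cd /eqP fcd]] /andP[/eqP ca ac].
      rewrite -fcd ca eqxx; apply: connect_trans ac (connect1 _).
      by rewrite /= ![_ \in U i]inE cD dD -fcd ca aP cd.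
    by rewrite eqxx connect0.
  (* Consecutive vertices of the path have connected fibres joined by an edge, so the union of the
     fibres is connected. *)
  have along q z : path (adj G') z q -> {subset z :: q <= L i :: p i} ->
      forall a b, a \in D -> b \in D -> f a = z -> f b \in z :: q -> connect e a b.
    elim: q z => [|z' q IH] z /=.
      move=> _ sub a b aD bD az; rewrite inE => /eqP bz.
      by apply: fibU; rewrite ?az ?bz // inE aD az sub ?mem_head.
    case/andP=> zz' qP sub a b aD bD az; rewrite inE => /orP[/eqP bz|bq].
      by apply: fibU; rewrite ?az ?bz // inE aD az sub ?mem_head.
    have [c [d [cD dD cd cz dz']]] := adjG' _ _ zz'.
    have aU : a \in U i by rewrite inE aD az sub ?mem_head.
    have cU : c \in U i by rewrite inE cD cz sub ?mem_head.
    have dU : d \in U i by rewrite inE dD dz' sub // inE mem_head orbT.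
    apply: connect_trans (fibU a c aU cD _) _; first by rewrite az cz.
    have ecd : connect e c d by apply: connect1; rewrite /= cU dU.
    apply: connect_trans ecd _.
    by apply: (IH z' qP) => // y yq; apply: sub; rewrite inE yq orbT.
  have [pPi _ _] := pP i; have LD := subsetP SD _ (LS i).
  have fromL a : a \in U i -> connect e (L i) a.
    rewrite inE => /andP[aD aP].
    by apply: (along _ _ pPi (fun _ h => h)) => //; apply: fS.
  by move=> a b /fromL La /fromL; apply: connect_trans; rewrite e_sym.
have allU y (i : 'I_r) : rho y = i -> y \in U i.
  apply: disjoint_crossings coords conU _ _ _ y i.
  - by move=> i i' y; rewrite !inE => /andP[_ h1] /andP[_ h2]; apply: disP h1 h2.
  - move=> i; have [rL kL] := LP i; exists (L i); split=> //.
    by rewrite inE (subsetP SD) //= fS // mem_head.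
  - move=> i; have [_ kM] := MP i; exists (M i) => //.
    have [_ pl _] := pP i.
    by rewrite inE (subsetP SD) //= fS // -pl mem_last.
have := allU x (Ordinal xr) erefl; rewrite inE => /andP[xD fx]; split=> // y xy.
have := allU y (Ordinal (proj1 (bd y))) erefl; rewrite inE -xy => /andP[_ fy].
by have /(congr1 val) := disP _ _ _ fx fy.
Qed.

Lemma grid_minor_card rho kap r N (S : {set V}) (G' : graph V) l' :
  grid_coords rho kap r N -> verts G = setT ->
  distance_preserving_minor G unit_length S G' l' ->
  (forall x, [\/ kap x = 0%N, kap x = N.-1, rho x = 0%N | rho x = r.-1] -> x \in S) ->
  #|verts G'| = #|V|.
Proof.
move=> coords GT dp bdS; have [GG' _ _] := dp.
have [|D [f [vG' SD fS adjG' fib]]] := minor_model GG'; first by rewrite GT subsetT.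
have rows := rows_survive coords dp SD fS adjG' fib.
have cols := rows_survive (grid_coordsC coords) dp SD fS adjG' fib.
have [_ inj _ _] := coords.
have rowS x : kap x = 0%N \/ kap x = N.-1 -> x \in S.
  by case=> h; apply: bdS; [constructor 1|constructor 2].
have colS x : rho x = 0%N \/ rho x = r.-1 -> x \in S.
  by case=> h; apply: bdS; [constructor 3|constructor 4].
rewrite vG' card_imset.
  rewrite -cardsT; congr #|pred_of_set _|; apply/setP => x; rewrite inE.
  by have [] := rows rowS x.
move=> x y xy; have [_ /(_ y xy) h1] := rows rowS x.
by have [_ /(_ y xy) h2] := cols colS x; apply: inj.
Qed.

End Grid.

(** * The lower bound *)

Section RelGraph.
Variables (V : finType) (e : rel V).

Let rel_edges := [set [set p.1; p.2] | p in [pred p : V * V | e p.1 p.2 && (p.1 != p.2)]].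

Lemma rel_graph_wf : [forall f in rel_edges, (f \subset [set: V]) && (#|f| == 2%N)].
Proof.
apply/forall_inP => f /imsetP[[x y] /andP[_ /= xy] ->].
by rewrite subsetT cards2 xy.
Qed.

Definition rel_graph : graph V := Graph rel_graph_wf.

Lemma adj_rel_graph x y : adj rel_graph x y = (x != y) && (e x y || e y x).
Proof.
apply/imsetP/andP => [[[a b] /andP[/= ab nab] /eq_set2[] [-> ->]]|[xy /orP[h|h]]].
- by rewrite ab nab.
- by rewrite eq_sym ab nab orbT.
- by exists (x, y); rewrite // inE /= h xy.
- by exists (y, x); rewrite 1?setUC // inE /= h eq_sym xy.
Qed.

End RelGraph.

(** * Path decompositions of grids *)

Section Line.
Variable n : nat.

Definition line := @rel_graph 'I_n (fun i j => i.+1 == j).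

Lemma adj_line (i j : 'I_n) : adj line i j = (i.+1 == j) || (j.+1 == i).
Proof. by rewrite adj_rel_graph -val_eqE /=; lia. Qed.

Lemma line_convex_connected (A : {set 'I_n}) :
  (forall i j k : 'I_n, i \in A -> k \in A -> i <= j <= k -> j \in A)%N ->
  connected_in line A.
Proof.
move=> convA.
have up d (i j : 'I_n) : i \in A -> j \in A -> (j = i + d :> nat)%N ->
    connect [rel a b in A | adj line a b] i j.
  elim: d j => [|d IH] j iA jA jE.
    by rewrite (_ : i = j) //; apply: val_inj; rewrite /= jE addn0.
  have kn : (i + d < n)%N by have := ltn_ord j; lia.
  have kA : Ordinal kn \in A by apply: (convA i _ j) => //=; lia.
  apply: connect_trans (IH _ iA kA erefl) (connect1 _).
  by rewrite /= kA jA adj_line /=; lia.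
move=> i j iA jA; case/orP: (leq_total i j) => ij.
  by apply: (up (j - i)%N); rewrite ?subnKC.
rewrite (sym_connect_sym (@rel_in_sym _ line A)).
by apply: (up (i - j)%N); rewrite ?subnKC.
Qed.

(* The two neighbours on a cycle of its largest vertex are both equal to the
   predecessor of that vertex. *)
Lemma line_tree : (0 < n)%N -> is_tree line.
Proof.
move=> n0; split.
- by apply/set0Pn; exists (Ordinal n0); rewrite inE.
- by apply: line_convex_connected => i j k; rewrite !inE.
move=> c /andP[cyc unc]; case: (posnP (size c)) => [->//|c0].
have [i0 i0c] : exists i, i \in c.
  by case: c c0 {cyc unc} => // a c _; exists a; rewrite mem_head.
case: (arg_maxnP (P := mem c) (fun i : 'I_n => i : nat) i0c) => m /= mc mmax.
have [k c' E] := rot_to mc.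
rewrite -(size_rot k) E; rewrite -(rot_cycle k) E in cyc.
rewrite -(rot_uniq k) E in unc.
have c'm z : z \in c' -> (z <= m)%N.
  by move=> zc'; apply: mmax; rewrite /= -(mem_rot k) E inE zc' orbT.
case: c' cyc unc c'm {E} => [|a c'] //=.
case/andP => ma; rewrite rcons_path => /andP[_ lm] /and3P[_ ac' _] c'm.
have pred_m (b : 'I_n) : (b <= m)%N -> adj line m b -> b.+1 = m.
  by rewrite adj_line; lia.
have la : last a c' = a.
  apply/val_inj/succn_inj; rewrite adj_sym in lm.
  exact: etrans (pred_m _ (c'm _ (mem_last a c')) lm)
    (esym (pred_m _ (c'm _ (mem_head _ _)) ma)).
by case: c' ac' la {lm c'm} => [|b c'] //= + lE; rewrite -{1}lE mem_last.
Qed.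

End Line.

Section GridGraph.
Variables r N : nat.

Definition grid := @rel_graph ('I_r * 'I_N)%type
  (fun x y => ((x.1 == y.1) && (x.2.+1 == y.2)) || ((x.2 == y.2) && (x.1.+1 == y.1))).

Definition grid_row (x : 'I_r * 'I_N) : nat := x.1.
Definition grid_col (x : 'I_r * 'I_N) : nat := x.2.

Lemma grid_coordsP : grid_coords grid grid_row grid_col r N.
Proof.
split.
- by move=> [i j]; rewrite /grid_row /grid_col /= !ltn_ord.
- by move=> [i j] [i' j']; rewrite /grid_row /grid_col /= => /val_inj -> /val_inj ->.
- by move=> i j ir jN; exists (Ordinal ir, Ordinal jN).
move=> [i j] [i' j']; rewrite adj_rel_graph /grid_row /grid_col /= xpair_eqE -!val_eqE /=.
by split; [lia|move=> h; lia].
Qed.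

(* Enumerate the vertices column by column: an edge joins vertices whose
   indices differ by at most r, so the windows of length r + 1 are bags. *)
Lemma grid_tree_decomposition : (0 < r)%N -> (0 < N)%N ->
  exists (I : finType) (T : graph I) (B : I -> {set 'I_r * 'I_N}),
    tree_decomposition grid T B /\ (width T B <= r)%N.
Proof.
move=> r0 N0; have [bd _ _ adjE] := grid_coordsP.
pose idx x := (grid_col x * r + grid_row x)%N.
have idx_lt x : (idx x < N * r)%N.
  have [h1 h2] := bd x; apply: leq_trans (_ : (grid_col x).+1 * r <= _)%N.
    by rewrite /idx mulSn addnC ltn_add2r.
  by rewrite leq_mul2r h2 orbT.
have idx_inj : injective idx.
  move=> x y E; have [hx _] := bd x; have [hy _] := bd y.
  have [_ inj _ _] := grid_coordsP; apply: inj.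
    by have := congr1 (modn^~ r) E; rewrite /idx !modnMDl !modn_small.
  by have := congr1 (divn^~ r) E; rewrite /idx !divnMDl // !divn_small // !addn0.
pose B (t : 'I_(N * r)) := [set x | (t <= idx x <= t + r)%N].
exists 'I_(N * r), (line (N * r)), B; split; last first.
  suff h : (\max_(i in verts (line (N * r))) #|B i| <= r.+1)%N.
    by rewrite /width -subn1 leq_subLR.
  apply/bigmax_leqP => t _; rewrite -[leqRHS]card_ord.
  rewrite -(card_in_imset (f := fun x => inord (idx x - t) : 'I_r.+1)).
    exact: max_card.
  move=> x y; rewrite !inE => hx hy /(congr1 val); rewrite /= !inordK; [|lia..].
  by move=> E; apply: idx_inj; lia.
have inB x : x \in B (Ordinal (idx_lt x)) by rewrite inE /=; lia.
split.
- by apply: line_tree; rewrite muln_gt0 N0.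
- apply/setP => x; rewrite !inE; apply/bigcupP.
  by exists (Ordinal (idx_lt x)); [rewrite inE|exact: inB].
- move=> e eG; have [x [y [E _ _ _]]] := edge_set2 eG; rewrite E in eG *.
  have window u v : (idx u <= idx v <= idx u + r)%N ->
      exists2 i, i \in verts (line (N * r)) & [set u; v] \subset B i.
    move=> uv; exists (Ordinal (idx_lt u)); first by rewrite inE.
    by apply/subsetP => z; rewrite !inE => /orP[]/eqP->; rewrite /= ?uv //; lia.
  have : (idx x <= idx y <= idx x + r)%N \/ (idx y <= idx x <= idx y + r)%N.
    move/adjE: eG; rewrite /idx => -[[-> [->|->]]|[-> [->|->]]]; rewrite ?mulSn; lia.
  by case=> /window //; rewrite setUC.
- move=> x _; apply: line_convex_connected => i j k; rewrite !inE /=; lia.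
Qed.

End GridGraph.

Lemma ex_is_min (P : nat -> Prop) n : P n -> exists2 m, is_min P m & (m <= n)%N.
Proof.
move=> Pn; have exP : exists n, `[< P n >] by exists n; apply/asboolP.
case: (ex_minnP exP) => m /asboolP Pm minm; exists m.
  by split=> // k Pk; apply: minm; apply/asboolP.
by apply: minm; apply/asboolP.
Qed.

Lemma grid_TW p r N : (0 < r <= p)%N -> (0 < N)%N -> TW p (grid r N).
Proof.
move=> /andP[r0 rp] N0.
have [I [T [B [TB wr]]]] := grid_tree_decomposition r0 N0.
have [|w wmin ww] := ex_is_min (P := fun n => exists (I : finType) (T : graph I)
  (B : I -> {set 'I_r * 'I_N}), tree_decomposition (grid r N) T B /\ width T B = n)
  (n := width T B).
  by exists I, T, B.
by exists w; [|exact: leq_trans ww (leq_trans wr rp)].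
Qed.

(** * Grids with a prescribed number of terminals *)

Lemma ex_superset_card (T : finType) (A : {set T}) k : (#|A| <= k <= #|T|)%N ->
  exists2 S : {set T}, A \subset S & #|S| = k.
Proof.
case/andP; elim: k => [|k IH] Ak kT.
  by exists A => //; apply/eqP; rewrite -leqn0.
have [E|ne] := eqVneq #|A| k.+1; first by exists A.
have [||S AS Sk] := IH; [by lia|exact: ltnW|].
have /subsetPn[x _ xS] : ~~ ([set: T] \subset S).
  by apply: contraL kT => /subset_leq_card; rewrite cardsT Sk ltnNge negbK.
by exists (x |: S); rewrite ?cardsU1 ?xS ?Sk // (subset_trans AS) ?subsetUr.
Qed.

(** The terminals are the boundary, padded to exactly k vertices. This is possible if k is at least
    the crude boundary count 2r + 2N, and also if all vertices are terminals. *)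
Lemma grid_bound (R : realType) p k m r N : admits_dp_minors R k (TW p) m ->
  (0 < r <= p)%N -> (0 < N)%N ->
  (k <= r * N)%N -> (2 * r + 2 * N <= k \/ k = r * N)%N -> (r * N <= m)%N.
Proof.
move=> adm rp N0 krN kb; have coords := grid_coordsP r N.
pose V := ('I_r * 'I_N)%type.
pose bd : {set V} := [set x | grid_col x == 0%N] :|: [set x | grid_col x == N.-1] :|:
  ([set x | grid_row x == 0%N] :|: [set x | grid_row x == r.-1]).
have Vc : #|{: V}| = (r * N)%N by rewrite card_prod !card_ord.
have bdk : (#|bd| <= k)%N.
  case: kb => [kb|->]; last by rewrite -Vc max_card.
  apply: leq_trans kb; rewrite !mul2n -!addnn.
  apply: leq_trans (leq_card_setU _ _) (leq_add _ _);
    by apply: leq_trans (leq_card_setU _ _) (leq_add _ _);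
    apply: card_column; first [exact: coords|exact: grid_coordsC coords].
have [|S bdS Sk] := @ex_superset_card _ bd k; first by rewrite bdk Vc.
have [] := adm V (grid r N) (fun=> 1) S (grid_TW rp N0).
- by move=> e _; apply: ler01.
- exact: subsetT.
- exact: Sk.
move=> G' [l' [dp]]; rewrite (grid_minor_card coords _ dp) ?Vc //.
move=> x hx; apply: (subsetP bdS); rewrite !inE.
by case: hx => ->; rewrite eqxx ?orbT.
Qed.

(** For p below 20 a single row consisting of k terminals suffices. Otherwise both sides of the grid
    are quarters rounded down: as p is at most k, the boundary has at most k vertices. From 20 on, p
    and k are at most five times their quarters, which gives 25; a quarter of p is also at least 5,
    so the grid has room for k terminals. *)
Lemma fstar_TW_ge (R : realType) p k m : (1 <= p)%N -> (p <= k)%N ->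
  admits_dp_minors R k (TW p) m -> (p * k <= 25 * m)%N.
Proof.
move=> p1 pk adm; case: (ltnP p 20) => p20.
  have : (1 * k <= m)%N.
    by apply: (grid_bound adm); rewrite ?mul1n //; [lia|right].
  by rewrite mul1n => km; apply: leq_mul => //; lia.
have [dr rE] : {a | (p %/ 4 = a)%N} by exists (p %/ 4)%N.
have [dN NE] : {a | (k %/ 4 = a)%N} by exists (k %/ 4)%N.
have rp : (p <= 5 * dr /\ 4 * dr <= p /\ 5 <= dr)%N by lia.
have kN : (k <= 5 * dN /\ 4 * dN <= k /\ 5 <= dN)%N by lia.
have : (dr * dN <= m)%N.
  apply: (grid_bound adm); [lia|lia| |left; lia].
  by apply: leq_trans (proj1 kN) _; rewrite leq_mul2r; lia.
move=> le; apply: leq_trans (leq_mul (proj1 rp) (proj1 kN)) _.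
by rewrite mulnACA leq_mul2l le orbT.
Qed.

Theorem theorem2 (R : realType) :
  exists c C : R, [/\ 0 < c, 0 < C &
    forall p k : nat, (1 <= p)%N -> (p <= k)%N ->
      exists m : nat, is_fstar R k (TW p) m /\
        c * p%:R * k%:R <= m%:R <= C * p%:R ^+ 3 * k%:R].
Proof.
exists 25%:R^-1, (3 * (8 * 1255))%N%:R; split; rewrite ?invr_gt0 ?ltr0n //.
(* The upper bound also shows that the minimum defining the number exists. *)
move=> p k p1 pk; have [m mmin mle] := ex_is_min (@fstar_TW_le R p k p1 pk).
exists m; split=> //; apply/andP; split.
  rewrite -mulrA ler_pdivrMl ?ltr0n // -!natrM ler_nat.
  exact: fstar_TW_ge p1 pk (proj1 mmin).
rewrite -natrX -!natrM ler_nat; apply: leq_trans mle _.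
by rewrite mulnACA (mulnC k) mulnA.
Qed.
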